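(* Consider the distributed online problem and Algorithm 1 described in the context, under Assumptions 1, 2 and 3 stated there. Let $\{x_{i,t}\}$ be the sequences generated by Algorithm 1 with $$\alpha_t=\frac{\alpha_0}{t^{\theta_1}},\qquad \beta_t=\frac{1}{t^{\theta_2}},\qquad \gamma_t=\frac{1}{t^{1-\theta_2}},\qquad \tau_t=\frac{\tau_0}{t^{\theta_3}},\qquad \forall t\in\mathbb{N}_+,$$ where $\theta_1\in(0,1)$, $\theta_2\in(0,1)$, and $\alpha_0$, $\tau_0$, $\theta_3$ are positive constants. Then, for any $T\in\mathbb{N}_+$ and any comparator sequence $y_{[T]}=(y_1,\dots,y_T)\in\mathcal{X}_T$, with path-length $P_T=\sum_{t=1}^{T-1}\|y_{t+1}-y_t\|$, $$\mathrm{Net\text{-}Reg}(\{x_{i,t}\},y_{[T]})=\begin{cases}\mathcal{O}\Big(\alpha_0T^{1-\theta_1}+T^{\theta_2}+\frac{\tau_0}{\alpha_0}T^{1+\theta_1-\theta_3}+\frac{T^{\theta_1}(1+P_T)}{\alpha_0}\Big), & \text{if } \theta_1<\theta_3<1+\theta_1,\\[4pt] \mathcal{O}\Big(\alpha_0T^{1-\theta_1}+T^{\theta_2}+\frac{\tau_0}{\alpha_0}\log(T)+\frac{T^{\theta_1}(1+P_T)}{\alpha_0}\Big), & \text{if } \theta_3=1+\theta_1,\\[4pt] \mathcal{O}\Big(\alpha_0T^{1-\theta_1}+T^{\theta_2}+\frac{\tau_0}{\alpha_0}+\frac{T^{\theta_1}(1+P_T)}{\alpha_0}\Big), & \text{if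 } \theta_3>1+\theta_1,\end{cases}$$ and $$\mathrm{Net\text{-}CCV}(\{x_{i,t}\})=\begin{cases}\mathcal{O}\big(\sqrt{\alpha_0}\,T^{1-\theta_1/2}+T^{1-\theta_2/2}+\sqrt{\tau_0}\,T^{1-\theta_3/2}\big), & \text{if } \theta_1<\theta_3<1,\\[4pt] \mathcal{O}\big(\sqrt{\alpha_0}\,T^{1-\theta_1/2}+T^{1-\theta_2/2}+\sqrt{\tau_0T\log(T)}\big), & \text{if } \theta_3=1,\\[4pt] \mathcal{O}\big(\sqrt{\alpha_0}\,T^{1-\theta_1/2}+T^{1-\theta_2/2}+\sqrt{\tau_0}\,T^{1/2}\big), & \text{if } \theta_3>1.\end{cases}$$
   Context: Notation: $[n]=\{1,\dots,n\}$; $\|\cdot\|$ is the Euclidean norm (spectral norm for matrices); $\mathcal{P}_{\mathbb{X}}$ is Euclidean projection onto $\mathbb{X}$; $[\cdot]_+$ is the componentwise positive part; $\mathrm{col}(\cdot)$ is vertical concatenation; vector inequalities are componentwise. Problem. There are $n$ agents, a set $\mathbb{X}\subseteq\mathbb{R}^p$, and for each $i\in[n]$, $t\in\mathbb{N}_+$ a local loss function $f_{i,t}:\mathbb{X}\to\mathbb{R}$ and a local constraint function $g_{i,t}:\mathbb{X}\to\mathbb{R}^{m_i}$; $m=\sum_{i=1}^n m_i$. Put $f_t(x)=\frac1n\sum_{j=1}^n f_{j,t}(x)$ and $g_t(x)=\mathrm{col}(g_{1,t}(x),\dots,g_{n,t}(x))$. For each $T$ let $\mathcal{X}_T=\{(x_1,\dots,x_T):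 x_t\in\mathbb{X},\ g_t(x_t)\le \mathbf{0}_m\ \forall t\in[T]\}$ and $\hat{\mathcal{X}}_T=\{(x,\dots,x): x\in\mathbb{X},\ g_t(x)\le\mathbf{0}_m\ \forall t\in[T]\}$; both are assumed non-empty. Communication at time $t$ is over a directed graph $\mathcal{G}_t=([n],\mathcal{E}_t)$ with mixing matrix $W_t\in\mathbb{R}^{n\times n}$ satisfying $[W_t]_{ij}>0$ if $(j,i)\in\mathcal{E}_t$ or $i=j$, and $[W_t]_{ij}=0$ otherwise. Assumption 1. (i) $\mathbb{X}$ is convex and closed, and $\|x\|\le R(\mathbb{X})$ for all $x\in\mathbb{X}$, for a positive constant $R(\mathbb{X})$. (ii) All $f_{i,t}$ and $g_{i,t}$ (componentwise) are convex, and for some constant $F_1>0$: $|f_{i,t}(x)-f_{i,t}(y)|\le F_1$ and $\|g_{i,t}(x)\|\le F_1$ for all $x,y\in\mathbb{X}$, $i$, $t$. (iii) Subgradients $\partial f_{i,t}(x)\in\mathbb{R}^p$ and $\partial g_{i,t}(x)\in\mathbb{R}^{p\times m_i}$ (whose $k$-th column is a subgradient of the $k$-th component of $g_{i,t}$) exist at every $x\in\mathbb{X}$, and for some constant $F_2>0$: $\|\partial f_{i,t}(x)\|\le F_2$, $\|\partial g_{i,t}(x)\|\le F_2$ for all $x\in\mathbb{X}$, $i$, $t$. Here $\partial[g_{i,t}(x)]_+\in\mathbb{R}^{p\times m_i}$ denotes a subgradient of $x\mapsto[g_{i,t}(x)]_+$: its $k$-th column is $s_k$ times the $k$-th column of $\partial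 g_{i,t}(x)$, with $s_k=1$ if the $k$-th component of $g_{i,t}(x)$ is positive, $s_k=0$ if it is negative, and $s_k\in[0,1]$ if it is zero. Assumption 2. (i) There is $w\in(0,1)$ with $[W_t]_{ij}\ge w$ whenever $[W_t]_{ij}>0$. (ii) Each $W_t$ is doubly stochastic. (iii) There is an integer $B>0$ such that for all $t\in\mathbb{N}_+$ the graph $([n],\bigcup_{l=0}^{B-1}\mathcal{E}_{t+l})$ is strongly connected. Assumption 3. The threshold sequence $\{\tau_t\}$ is non-increasing. Algorithm 1 (with positive parameter sequences $\{\alpha_t\},\{\beta_t\},\{\gamma_t\},\{\tau_t\}$). Initialize $x_{i,1}\in\mathbb{X}$ arbitrarily, $\hat x_{i,1}=x_{i,1}$, $q_{i,1}=\mathbf{0}_{m_i}$. For $t=1,2,\dots$ and each $i\in[n]$: $z_{i,t+1}=\sum_{j=1}^n[W_t]_{ij}\hat x_{j,t}$; $\omega_{i,t+1}=\partial f_{i,t}(x_{i,t})+\partial[g_{i,t}(x_{i,t})]_+\,q_{i,t}$; $x_{i,t+1}=\mathcal{P}_{\mathbb{X}}(z_{i,t+1}-\alpha_{t+1}\omega_{i,t+1})$; $q_{i,t+1}=\big[(1-\beta_{t+1}\gamma_{t+1})q_{i,t}+\gamma_{t+1}\big([g_{i,t}(x_{i,t})]_+ +(\partial[g_{i,t}(x_{i,t})]_+)^T(x_{i,t+1}-x_{i,t})\big)\big]_+$; if $\|x_{i,t+1}-\hat x_{i,t}\|\ge\tau_{t+1}$ set $\hat x_{i,t+1}=x_{i,t+1}$,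 else set $\hat x_{i,t+1}=\hat x_{i,t}$. Performance metrics: $\mathrm{Net\text{-}Reg}(\{x_{i,t}\},y_{[T]})=\frac1n\sum_{i=1}^n\sum_{t=1}^T f_t(x_{i,t})-\sum_{t=1}^T f_t(y_t)$ and $\mathrm{Net\text{-}CCV}(\{x_{i,t}\})=\frac1n\sum_{i=1}^n\sum_{t=1}^T\|[g_t(x_{i,t})]_+\|$. Convention: $A=\mathcal{O}(B)$ means $A\le C\,B$ for all sufficiently large $T$, where the constant $C>0$ (and the threshold on $T$) does not depend on $T$ or on the comparator sequence, but may depend on the fixed problem data and algorithm parameters. *)

(* Defs.v *)
From mathcomp Require Export all_boot all_order all_algebra.
From mathcomp Require Export all_classical all_reals all_analysis.
Set Implicit Arguments.
Unset Strict Implicit.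
Unset Printing Implicit Defensive.
Import Order.TTheory GRing.Theory Num.Theory.
Import numFieldNormedType.Exports.
Local Open Scope classical_set_scope.
Local Open Scope ring_scope.

Section Euclidean.
Context {R : realType}.

Definition edot k (u v : 'cV[R]_k) : R := \sum_(j < k) u j 0 * v j 0.

(* The library norm of a matrix is the max norm, whence a separate Euclidean
   norm; both induce the topology used in [closed] below. *)
Definition enorm k (v : 'cV[R]_k) : R := Num.sqrt (edot v v).

Definition spectral_norm k l (A : 'M[R]_(k, l)) : R :=
  sup [set enorm (A *m v) | v in [set v : 'cV[R]_l | enorm v <= 1]].

Definition is_eproj k (X : set 'cV[R]_k) (v x : 'cV[R]_k) : Prop :=
  X x /\ forall y, X y -> enorm (v - x) <= enorm (v - y).

(* Only meaningful when a nearest point exists and is unique, in particular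
   when X is non-empty, closed and convex; the default value is 0. *)
Definition eproj k (X : set 'cV[R]_k) (v : 'cV[R]_k) : 'cV[R]_k :=
  xget 0 [set x | is_eproj X v x].

Definition posmx k (v : 'cV[R]_k) : 'cV[R]_k := map_mx (Num.max ^~ 0) v.

Definition nonpos k (v : 'cV[R]_k) : Prop := forall j, v j 0 <= 0.

Definition is_subgradient k (X : set 'cV[R]_k) (h : 'cV[R]_k -> R)
    (x s : 'cV[R]_k) : Prop :=
  forall y, X y -> h x + edot s (y - x) <= h y.

(* D is a subgradient of the positive part of a vector function whose value at
   the given point is v and whose subgradient there is G. *)
Definition is_pos_subgradient k l (v : 'cV[R]_l) (G D : 'M[R]_(k, l)) : Prop :=
  forall j : 'I_l, exists s : R,
    [/\ 0 <= s <= 1, 0 < v j 0 -> s = 1, v j 0 < 0 -> s = 0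
      & col j D = s *: col j G].

End Euclidean.

(* Time is t = 1, 2, ...: every nat-indexed family below is only constrained
   at positive indices.  The losses and constraints are total functions, only
   constrained on X. *)
Section OnlineProblem.
Context {R : realType} {n p : nat} {m : 'I_n -> nat}.
Variable X : set 'cV[R]_p.
Variable f : 'I_n -> nat -> 'cV[R]_p -> R.
Variable g : forall i : 'I_n, nat -> 'cV[R]_p -> 'cV[R]_(m i).

Definition global_loss (t : nat) (x : 'cV[R]_p) : R :=
  n%:R^-1 * \sum_(j < n) f j t x.

Definition global_constraint (t : nat) (x : 'cV[R]_p) :
  'cV[R]_(\sum_(i < n) m i) := \mxcol_(i < n) g i t x.

(* A sequence (y_1, ..., y_T) is a function y on nat whose values outside of
   {1, ..., T} are irrelevant. *)
Definition feasible_seqs (T : nat) : set (nat -> 'cV[R]_p) :=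
  [set y | forall t, (1 <= t <= T)%N ->
     X (y t) /\ nonpos (global_constraint t (y t))].

Definition static_feasible_seqs (T : nat) : set (nat -> 'cV[R]_p) :=
  [set y | exists2 x, X x & forall t, (1 <= t <= T)%N ->
     y t = x /\ nonpos (global_constraint t x)].

Definition path_length (T : nat) (y : nat -> 'cV[R]_p) : R :=
  \sum_(1 <= t < T) enorm (y t.+1 - y t).

Definition net_reg (x : 'I_n -> nat -> 'cV[R]_p) (T : nat)
    (y : nat -> 'cV[R]_p) : R :=
  n%:R^-1 * (\sum_(i < n) \sum_(1 <= t < T.+1) global_loss t (x i t))
  - \sum_(1 <= t < T.+1) global_loss t (y t).

Definition net_ccv (x : 'I_n -> nat -> 'cV[R]_p) (T : nat) : R :=
  n%:R^-1 * \sum_(i < n) \sum_(1 <= t < T.+1)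
    enorm (posmx (global_constraint t (x i t))).

Variable df : 'I_n -> nat -> 'cV[R]_p -> 'cV[R]_p.
Variable dg : forall i : 'I_n, nat -> 'cV[R]_p -> 'M[R]_(p, m i).
Variable dgpos : forall i : 'I_n, nat -> 'cV[R]_p -> 'M[R]_(p, m i).

Record assumption1 (RX F1 F2 : R) : Prop := Assumption1 {
  a1_RX_gt0 : 0 < RX;
  a1_F1_gt0 : 0 < F1;
  a1_F2_gt0 : 0 < F2;
  a1_X_convex : convex_set X;
  a1_X_closed : closed X;
  a1_X_bounded : forall x, X x -> enorm x <= RX;
  a1_f_convex : forall i t, (1 <= t)%N -> convex_function X (f i t);
  a1_g_convex : forall i t (j : 'I_(m i)), (1 <= t)%N ->
    convex_function X (fun x => g i t x j 0);
  a1_f_bounded : forall i t x y, (1 <= t)%N -> X x -> X y ->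
    `|f i t x - f i t y| <= F1;
  a1_g_bounded : forall i t x, (1 <= t)%N -> X x -> enorm (g i t x) <= F1;
  a1_df : forall i t x, (1 <= t)%N -> X x ->
    is_subgradient X (f i t) x (df i t x);
  a1_dg : forall i t x (j : 'I_(m i)), (1 <= t)%N -> X x ->
    is_subgradient X (fun x => g i t x j 0) x (col j (dg i t x));
  a1_df_bounded : forall i t x, (1 <= t)%N -> X x -> enorm (df i t x) <= F2;
  a1_dg_bounded : forall i t x, (1 <= t)%N -> X x ->
    spectral_norm (dg i t x) <= F2;
  a1_dgpos : forall i t x, (1 <= t)%N -> X x ->
    is_pos_subgradient (g i t x) (dg i t x) (dgpos i t x)
}.

Variable W : nat -> 'M[R]_n.
Variables alpha beta gamma tau : nat -> R.

Record algorithm1 (x xhat z omega : 'I_n -> nat -> 'cV[R]_p)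
    (q : forall i : 'I_n, nat -> 'cV[R]_(m i)) : Prop := Algorithm1 {
  alg_x1 : forall i, X (x i 1%N);
  alg_xhat1 : forall i, xhat i 1%N = x i 1%N;
  alg_q1 : forall i, q i 1%N = 0;
  alg_z : forall i t, (1 <= t)%N ->
    z i t.+1 = \sum_(j < n) W t i j *: xhat j t;
  alg_omega : forall i t, (1 <= t)%N ->
    omega i t.+1 = df i t (x i t) + dgpos i t (x i t) *m q i t;
  alg_x : forall i t, (1 <= t)%N ->
    x i t.+1 = eproj X (z i t.+1 - alpha t.+1 *: omega i t.+1);
  alg_q : forall i t, (1 <= t)%N ->
    q i t.+1 = posmx ((1 - beta t.+1 * gamma t.+1) *: q i t
      + gamma t.+1 *: (posmx (g i t (x i t))
          + (dgpos i t (x i t))^T *m (x i t.+1 - x i t)));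
  alg_xhat : forall i t, (1 <= t)%N ->
    xhat i t.+1 =
      if tau t.+1 <= enorm (x i t.+1 - xhat i t) then x i t.+1 else xhat i t
}.

End OnlineProblem.

Section Network.
Context {R : realType} {n : nat}.
(* [E t j i] is the directed edge (j, i) of the graph at time t. *)
Variable E : nat -> rel 'I_n.
Variable W : nat -> 'M[R]_n.

Definition mixing : Prop := forall t i j, (1 <= t)%N ->
  (E t j i || (i == j) -> 0 < W t i j) /\
  (~~ (E t j i || (i == j)) -> W t i j = 0).

Definition doubly_stochastic (A : 'M[R]_n) : Prop :=
  [/\ forall i j, 0 <= A i j, forall i, \sum_(j < n) A i j = 1
    & forall j, \sum_(i < n) A i j = 1].

Definition strongly_connected (e : rel 'I_n) : Prop :=
  forall i j, connect e i j.

Record assumption2 (w : R) (B : nat) : Prop := Assumption2 {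
  a2_w : 0 < w < 1;
  a2_W_lb : forall t i j, (1 <= t)%N -> 0 < W t i j -> w <= W t i j;
  a2_W_ds : forall t, (1 <= t)%N -> doubly_stochastic (W t);
  a2_B_gt0 : (0 < B)%N;
  a2_connected : forall t, (1 <= t)%N ->
    strongly_connected [rel j i | [exists l : 'I_B, E (t + l) j i]]
}.

End Network.

Definition assumption3 {R : realType} (tau : nat -> R) : Prop :=
  forall t, (1 <= t)%N -> tau t.+1 <= tau t.

(* Main.v *)
Require Import Defs.
From mathcomp Require Import ring lra zify.
Set Implicit Arguments.
Unset Strict Implicit.
Unset Printing Implicit Defensive.
Import Order.TTheory GRing.Theory Num.Theory.
Import numFieldNormedType.Exports.
Local Open Scope classical_set_scope.
Local Open Scope ring_scope.

(* The obtuse-angle inequality of the projection and the drift of |q|^2 add up,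
   because the inner product of q with the linearised constraint occurs in both:
   for y in X with g_{i,t}(y) <= 0,
     f(x_t) - f(y) + (|q_{t+1}|^2 - |q_t|^2) / (2 gamma) + beta |q_t|^2
       + |eps_t|^2 / (2 alpha)
     <= 2 c^2 gamma + F2 |x_{t+1} - x_t|
       + (|z_{t+1} - y|^2 - |x_{t+1} - y|^2) / (2 alpha),
   where eps_t = x_{t+1} - z_{t+1} and c bounds the linearised constraint.  Double
   stochasticity and the trigger rule make the last bracket telescope up to
   O(tau_t), and 1 / gamma_{t+1} - 1 / gamma_t <= beta_{t+1} takes care of the
   dual terms.  Over n B steps the products of mixing matrices contract the
   diameter of the broadcast points, so the consensus errors sum to
   O(1 + sum |eps_t| + sum tau_t), and Young's inequality absorbs |eps_t| into
   |eps_t|^2 / (2 alpha).  This gives the regret.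

   For a static feasible y the same inequality bounds |q_{T+1}|^2 / gamma
   + sum beta |q_t|^2 by O(T), and its multiple by alpha bounds sum |eps_t|^2 by
   O(1 + sum alpha_t + sum tau_t).  Since [g(x_t)]_+ is at most
   (q_{t+1} - q_t) / gamma + beta q_t + F2 |x_{t+1} - x_t|, summation by parts
   and the weighted AM-GM inequality give the constraint violation. *)

(** * Euclidean geometry *)

Lemma natr_mul_sum (R : realType) k (c : R) : k%:R * c = \sum_(i < k) c.
Proof. by rewrite mulr_natl sumr_const card_ord. Qed.

Section EuclideanNorm.
Context {R : realType}.
Implicit Types (k l : nat) (a : R).

Lemma edotC k (u v : 'cV[R]_k) : edot u v = edot v u.
Proof. by apply: eq_bigr => j _; rewrite mulrC. Qed.

Lemma edotDl k (u v w : 'cV[R]_k) : edot (u + v) w = edot u w + edot v w.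
Proof. by rewrite -big_split; apply: eq_bigr => j _; rewrite mxE mulrDl. Qed.

Lemma edotZl k a (u v : 'cV[R]_k) : edot (a *: u) v = a * edot u v.
Proof. by rewrite mulr_sumr; apply: eq_bigr => j _; rewrite mxE mulrA. Qed.

Lemma edotNl k (u v : 'cV[R]_k) : edot (- u) v = - edot u v.
Proof. by rewrite -scaleN1r edotZl mulN1r. Qed.

Lemma edotBl k (u v w : 'cV[R]_k) : edot (u - v) w = edot u w - edot v w.
Proof. by rewrite edotDl edotNl. Qed.

Lemma edotDr k (u v w : 'cV[R]_k) : edot w (u + v) = edot w u + edot w v.
Proof. by rewrite edotC edotDl !(edotC w). Qed.

Lemma edotZr k a (u v : 'cV[R]_k) : edot u (a *: v) = a * edot u v.
Proof. by rewrite edotC edotZl edotC. Qed.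

Lemma edotNr k (u v : 'cV[R]_k) : edot u (- v) = - edot u v.
Proof. by rewrite edotC edotNl edotC. Qed.

Lemma edotBr k (u v w : 'cV[R]_k) : edot w (u - v) = edot w u - edot w v.
Proof. by rewrite edotDr edotNr. Qed.

Definition edotE := (edotDl, edotDr, edotNl, edotNr, edotZl, edotZr).

Lemma edot_mulmx k l (A : 'M[R]_(k, l)) v (u : 'cV[R]_k) :
  edot (A *m v) u = edot v (A^T *m u).
Proof.
rewrite /edot; under eq_bigr do rewrite mxE mulr_suml.
rewrite exchange_big; apply: eq_bigr => j _ /=; rewrite mxE mulr_sumr.
by apply: eq_bigr => i _; rewrite mxE mulrCA mulrA.
Qed.

Lemma tr_mulmx_edot k l (A : 'M[R]_(k, l)) (u : 'cV[R]_k) j :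
  (A^T *m u) j 0 = edot (col j A) u.
Proof. by rewrite mxE; apply: eq_bigr => i _; rewrite !mxE. Qed.

Lemma edotvv_ge0 k (v : 'cV[R]_k) : 0 <= edot v v.
Proof. by apply: sumr_ge0 => j _; rewrite -expr2 sqr_ge0. Qed.

Lemma enorm_ge0 k (v : 'cV[R]_k) : 0 <= enorm v.
Proof. exact: sqrtr_ge0. Qed.
Hint Resolve enorm_ge0 : core.

Lemma enorm_sqr k (v : 'cV[R]_k) : enorm v ^+ 2 = edot v v.
Proof. by rewrite sqr_sqrtr ?edotvv_ge0. Qed.

Lemma enorm0 k : enorm (0 : 'cV[R]_k) = 0.
Proof. by rewrite /enorm /edot big1 ?sqrtr0 // => j _; rewrite mxE mul0r. Qed.

Lemma enormZ k a (v : 'cV[R]_k) : enorm (a *: v) = `|a| * enorm v.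
Proof.
by rewrite /enorm !edotE mulrA -expr2 sqrtrM ?sqr_ge0 // sqrtr_sqr.
Qed.

Lemma enormN k (v : 'cV[R]_k) : enorm (- v) = enorm v.
Proof. by rewrite -scaleN1r enormZ normrN1 mul1r. Qed.

Lemma enorm_distC k (u v : 'cV[R]_k) : enorm (u - v) = enorm (v - u).
Proof. by rewrite -opprB enormN. Qed.

Lemma ler_enorm k l (u : 'cV[R]_k) (v : 'cV[R]_l) :
  edot u u <= edot v v -> enorm u <= enorm v.
Proof. by move=> uv; rewrite ler_wsqrtr. Qed.

Lemma coord_le_enorm k (v : 'cV[R]_k) j : `|v j 0| <= enorm v.
Proof.
rewrite -sqrtr_sqr ler_wsqrtr // /edot (bigD1 j) //= -expr2 lerDl sumr_ge0 //.
by move=> i _; rewrite -expr2 sqr_ge0.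
Qed.

(** Cauchy-Schwarz, by expanding the square of |v| u - |u| v and dividing by |u| |v|. A vector of
    norm zero has zero coordinates and is treated apart. *)
Lemma edot_le_enorm k (u v : 'cV[R]_k) : edot u v <= enorm u * enorm v.
Proof.
have [/eqP u0|u0] := boolP (enorm u == 0).
  rewrite u0 mul0r /edot big1 // => j _.
  have := coord_le_enorm u j; rewrite u0 normr_le0 => /eqP ->.
  by rewrite mul0r.
have [/eqP v0|v0] := boolP (enorm v == 0).
  rewrite v0 mulr0 /edot big1 // => j _.
  have := coord_le_enorm v j; rewrite v0 normr_le0 => /eqP ->.
  by rewrite mulr0.
have uv_gt0 : 0 < enorm u * enorm v by rewrite mulr_gt0 // lt0r ?u0 ?v0 /=.
have := edotvv_ge0 (enorm v *: u - enorm u *: v).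
rewrite !edotE (edotC v u) -!enorm_sqr => H.
rewrite -(ler_pM2l uv_gt0); move: H; nra.
Qed.

Lemma ler_enormD k (u v : 'cV[R]_k) : enorm (u + v) <= enorm u + enorm v.
Proof.
rewrite -ler_sqr ?nnegrE ?addr_ge0 // enorm_sqr !edotE (edotC v u).
have := edot_le_enorm u v; rewrite -!enorm_sqr; nra.
Qed.

Lemma ler_enormB k (u v : 'cV[R]_k) : enorm (u - v) <= enorm u + enorm v.
Proof. by rewrite (le_trans (ler_enormD _ _)) // enormN. Qed.

Lemma ler_enorm_dist k (v u w : 'cV[R]_k) :
  enorm (u - w) <= enorm (u - v) + enorm (v - w).
Proof. by have := ler_enormD (u - v) (v - w); rewrite addrA subrK. Qed.

Lemma norm_edot_le k (u v : 'cV[R]_k) : `|edot u v| <= enorm u * enorm v.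
Proof.
rewrite ler_norml edot_le_enorm andbT lerNl -edotNl.
by rewrite (le_trans (edot_le_enorm _ _)) // enormN.
Qed.

Lemma ler_enorm_sum k (I : Type) (r : seq I) (P : pred I) (F : I -> 'cV[R]_k) :
  enorm (\sum_(i <- r | P i) F i) <= \sum_(i <- r | P i) enorm (F i).
Proof.
elim/big_ind2: _ => [|x1 x2 y1 y2 h1 h2|//]; first by rewrite enorm0.
by rewrite (le_trans (ler_enormD _ _)) // lerD.
Qed.

Lemma enorm_le_sum_coord k (v : 'cV[R]_k) : enorm v <= \sum_j `|v j 0|.
Proof.
have vE : v = \sum_j v j 0 *: delta_mx j 0.
  by rewrite [LHS]matrix_sum_delta; apply: eq_bigr => i _; rewrite big_ord1.
rewrite {1}vE (le_trans (ler_enorm_sum _ _ _)) // ler_sum // => j _.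
rewrite enormZ ler_piMr // /enorm /edot (bigD1 j) //= big1; last first.
  by move=> i /negPf ij; rewrite mxE ij mul0r.
by rewrite mxE !eqxx mul1r addr0 sqrtr1.
Qed.

(** Jensen's inequality for the square: the variance about the weighted mean is non-negative. *)
Lemma sqr_sum_convex (I : finType) (c r : I -> R) : (forall i, 0 <= c i) ->
  \sum_i c i = 1 -> (\sum_i c i * r i) ^+ 2 <= \sum_i c i * r i ^+ 2.
Proof.
move=> c0 c1.
have varE s : \sum_i c i * (r i - s) ^+ 2 =
    \sum_i c i * r i ^+ 2 - 2 * s * (\sum_i c i * r i) + s ^+ 2 * \sum_i c i.
  rewrite !mulr_sumr -sumrB -big_split /=; apply: eq_bigr => i _; ring.
have : 0 <= \sum_i c i * (r i - \sum_i c i * r i) ^+ 2.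
  by apply: sumr_ge0 => i _; rewrite mulr_ge0 ?sqr_ge0.
rewrite varE c1; lra.
Qed.

Lemma enorm_convex_sqr k (I : finType) (c : I -> R) (v : I -> 'cV[R]_k) :
  (forall i, 0 <= c i) -> \sum_i c i = 1 ->
  enorm (\sum_i c i *: v i) ^+ 2 <= \sum_i c i * enorm (v i) ^+ 2.
Proof.
move=> c0 c1; apply: le_trans (sqr_sum_convex (fun i => enorm (v i)) c0 c1).
rewrite lerXn2r ?nnegrE ?sumr_ge0 // => [i _|]; first by rewrite mulr_ge0.
rewrite (le_trans (ler_enorm_sum _ _ _)) // ler_sum // => i _.
by rewrite enormZ ger0_norm.
Qed.

Lemma posmxE k (v : 'cV[R]_k) j : posmx v j 0 = Num.max (v j 0) 0.
Proof. by rewrite mxE. Qed.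

Lemma edot_posmx_le k (v : 'cV[R]_k) : edot (posmx v) (posmx v) <= edot v v.
Proof.
apply: ler_sum => j _; rewrite posmxE; case: (leP (v j 0) 0) => // _.
by rewrite mul0r -expr2 sqr_ge0.
Qed.

Lemma enorm_posmx_le k (v : 'cV[R]_k) : enorm (posmx v) <= enorm v.
Proof. exact/ler_enorm/edot_posmx_le. Qed.

(** A column is the image of a unit vector. The supremum bounds it only because the set of images is
    bounded, here by the sum of the column norms. *)
Lemma enorm_col_le k l (A : 'M[R]_(k, l)) j :
  enorm (col j A) <= spectral_norm A.
Proof.
have dE : col j A = A *m (delta_mx j 0 : 'cV_l) by rewrite colE.
rewrite dE; apply: ub_le_sup; last first.
  exists (delta_mx j 0) => //=; rewrite /enorm /edot (bigD1 j) //= big1.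
    by rewrite mxE !eqxx mul1r addr0 sqrtr1.
  by move=> i /negPf ij; rewrite mxE ij mul0r.
exists (\sum_i enorm (col i A)) => _ [v /= v1 <-].
have -> : A *m v = \sum_i v i 0 *: col i A.
  apply/matrixP => a b; rewrite mxE summxE; apply: eq_bigr => i _.
  by rewrite !mxE mulrC (ord1 b).
rewrite (le_trans (ler_enorm_sum _ _ _)) // ler_sum // => i _.
by rewrite enormZ ler_piMl // (le_trans (coord_le_enorm _ _)).
Qed.

End EuclideanNorm.
#[export] Hint Extern 0 (is_true (0 <= enorm _)) => exact: enorm_ge0 : core.

(** * Existence and variational inequality of the Euclidean projection *)

Section Projection.
Context {R : realType} {k : nat}.
Variable X : set 'cV[R]_k.

Lemma trmx_continuous : continuous (fun v : 'rV[R]_k => v^T).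
Proof.
move=> /= M s /= /(nbhs_ballP (M^T)) [e e0 es].
apply/nbhs_ballP; exists e => //= N [_ MN]; apply: es; split => // i j.
by rewrite !mxE; exact: MN.
Qed.

Lemma edot_trmx_continuous (a : 'cV[R]_k) :
  continuous (fun v : 'rV[R]_k => edot (a - v^T) (a - v^T)).
Proof.
move=> v; rewrite /edot.
under eq_fun do under eq_bigr do rewrite !mxE.
have cj j : continuous (fun v : 'rV[R]_k => a j 0 - v 0 j).
  by move=> u; apply: continuousB;
    [exact: cst_continuous | exact: coord_continuous].
apply: continuous_big v => [|j _ v]; first exact: add_continuous.
exact: continuousM (cj j v) (cj j v).
Qed.

(** A closed bounded set, transposed to row vectors, is compact, so the squared distance to [a]
    attains its minimum; hence [xget] cannot fall back on its default value. *)
Lemma eprojP (RX : R) (a : 'cV[R]_k) : X !=set0 -> closed X ->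
  (forall x, X x -> enorm x <= RX) -> is_eproj X a (eproj X a).
Proof.
move=> [x0 Xx0] Xcl Xbd; rewrite /eproj; case: xgetP => [x _ //|noproj].
have Acpt : compact [set v : 'rV[R]_k | X v^T].
  apply: bounded_closed_compact; last first.
    by apply: closed_comp Xcl => v _; exact: trmx_continuous.
  exists RX; split; first by rewrite num_real.
  move=> M RXM v /= Xv; rewrite /Num.norm /= mx_normrE.
  apply: bigmax_le => [|[i j] _ /=].
    exact: le_trans (enorm_ge0 _) (le_trans (Xbd _ Xx0) (ltW RXM)).
  rewrite (ord1 i) (le_trans _ (ltW RXM)) // (le_trans _ (Xbd _ Xv)) //.
  by have := coord_le_enorm v^T j; rewrite mxE.
have [|c] := compact_EVT_min _ Acpt
  (continuous_subspaceT (edot_trmx_continuous (a := a))).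
  by exists x0^T => /=; rewrite trmxK.
rewrite inE /= => Xc cmin; case: (noproj c^T); split => // y Xy.
by apply: ler_enorm; have := cmin y^T; rewrite inE /= trmxK; apply.
Qed.

Hypothesis Xcvx : convex_set X.

(** Moving from x towards y by a fraction t stays in the convex set and cannot reduce the distance
    to a, so 2 d <= t N, with d the inner product and N = |y - x|^2. If d were positive, t = d / (d
    + N) would give t N <= d, a contradiction. *)
Lemma is_eproj_obtuse (a x y : 'cV[R]_k) : is_eproj X a x -> X y ->
  edot (a - x) (y - x) <= 0.
Proof.
move=> [Xx xmin] Xy; rewrite leNgt; apply/negP => dpos.
set d := edot (a - x) (y - x) in dpos; set N := edot (y - x) (y - x).
have N0 : 0 <= N by exact: edotvv_ge0.
pose t := d / (d + N).
have dN : 0 < d + N by lra.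
have t0 : 0 < t by rewrite divr_gt0.
have t1 : t <= 1 by rewrite ler_pdivrMr // mul1r; lra.
have Xc : X (x + t *: (y - x)).
  have : X (t *: y + (1 - t) *: x).
    have := @Xcvx y x (@Itv01 R t (ltW t0) t1).
    by rewrite !inE => /(_ Xy Xx).
  by rewrite scalerBr scalerBl scale1r addrCA addrA.
have : edot (a - x) (a - x) <=
    edot (a - x - t *: (y - x)) (a - x - t *: (y - x)).
  by rewrite -!enorm_sqr ler_sqr ?nnegrE ?enorm_ge0 // -addrA -opprD; exact: xmin.
move: (a - x) (y - x) @d @N dpos N0 @t dN t0 t1 {Xc} => u v d N dpos N0 t dN t0 t1.
rewrite !edotE (edotC v u) -/d -/N => H.
have : t * (2 * d) <= t * (t * N) by lra.
rewrite ler_pM2l //.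
have : t * (d + N) = d by rewrite /t divfK // gt_eqF.
nra.
Qed.

End Projection.

(** * Power sums *)

Section PowerSums.
Context {R : realType}.
Implicit Types (x u r s : R) (T : nat).

Lemma powR_expR x r : 0 < x -> x `^ r = expR (r * ln x).
Proof. by move=> x0; rewrite /powR gt_eqF. Qed.

(** Discrete derivative of the logarithm: ln (1 - u) <= - u at u = 1 / (T + 1). *)
Lemma ln_succ_ge T : (0 < T)%N ->
  ln (T%:R : R) + T.+1%:R^-1 <= ln T.+1%:R.
Proof.
move=> T0; have T1 : (0 : R) < T%:R by rewrite ltr0n.
have T2 : (0 : R) < T.+1%:R by rewrite ltr0n.
have TE : (T%:R : R) = T.+1%:R * (1 - T.+1%:R^-1).
  by rewrite mulrBr mulr1 divff ?gt_eqF // -natr1 addrK.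
have u0 : 0 < 1 - (T.+1%:R : R)^-1 by rewrite -(pmulr_rgt0 _ T2) -TE.
rewrite {1}TE lnM ?posrE //.
have /le_ln1Dx : -1 < - T.+1%:R^-1 :> R by rewrite ltrN2 -subr_gt0.
by rewrite -addrA gerDl -lerBrDr sub0r.
Qed.

(** Concavity of [ln] between 1 - u and 1, with weights r and 1 - r; at u = 1 the power is 0. *)
Lemma powR_Bernoulli u r : 0 <= u <= 1 -> 0 < r <= 1 ->
  (1 - u) `^ r <= 1 - r * u.
Proof.
move=> /andP[u0 u1] /andP[r0 r1].
have [->|u_neq1] := eqVneq u 1; first by rewrite subrr powR0 ?gt_eqF //; lra.
have u_lt1 : 0 < 1 - u by rewrite subr_gt0 lt_neqAle u_neq1.
rewrite powR_expR // -[leRHS]lnK ?posrE; last by nra.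
rewrite ler_expR.
have : r * ln (1 - u) + (1 - r) * ln 1 <= ln (r * (1 - u) + (1 - r) * 1).
  exact: (concave_ln (@Itv01 R r (ltW r0) r1) u_lt1 ltr01).
rewrite ln1 mulr0 addr0 => /le_trans; apply.
by rewrite (_ : r * _ + _ = 1 - r * u) //; ring.
Qed.

(** Comparison with the integral of t^(r-1), by induction: Bernoulli at u = 1 / (T + 1) gives T^r <=
    (T + 1)^r - r (T + 1)^(r-1). *)
Lemma sum_powR_lt1 r T : 0 < r <= 1 ->
  \sum_(1 <= t < T.+1) t%:R `^ (r - 1) <= r^-1 * T%:R `^ r.
Proof.
move=> /[dup] r01 /andP[r0 r1]; elim: T => [|T IH].
  by rewrite big_geq // mulr_ge0 ?invr_ge0 ?powR_ge0 // ltW.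
rewrite big_nat_recr //=.
have T2 : (0 : R) < T.+1%:R by rewrite ltr0n.
apply: le_trans (lerD IH (lexx _)) _.
have TE : (T%:R : R) = T.+1%:R * (1 - T.+1%:R^-1).
  by rewrite mulrBr mulr1 divff ?gt_eqF // -natr1 addrK.
have u01 : 0 <= (T.+1%:R : R)^-1 <= 1.
  by rewrite invr_ge0 ltW //= invf_le1 // ler1n.
have -> : (T.+1%:R : R) `^ (r - 1) = T.+1%:R `^ r * T.+1%:R^-1.
  by rewrite powRB ?powRr1 ?(ltW T2) // (gt_eqF T2) implybT.
rewrite TE powRM ?(ltW T2) //; last by rewrite subr_ge0; case/andP: u01.
rewrite -(ler_pM2l r0) mulrDr !mulrA divff ?gt_eqF // !mul1r.
have := ler_wpM2l (powR_ge0 T.+1%:R r) (powR_Bernoulli u01 r01).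
move: (T.+1%:R^-1) ((1 - _) `^ r) (T.+1%:R `^ r) => V b a; lra.
Qed.

Lemma sum_inv_le T : (0 < T)%N ->
  \sum_(1 <= t < T.+1) (t%:R : R)^-1 <= 1 + ln T%:R.
Proof.
elim: T => // -[|T] IH _; first by rewrite big_nat1 ln1 invr1 addr0.
rewrite big_nat_recr //= (le_trans (lerD (IH isT) (lexx _))) //.
by rewrite -addrA lerD2l ln_succ_ge.
Qed.

Lemma sum_powR_gt1 s T : 0 < s ->
  \sum_(1 <= t < T.+1) t%:R `^ (- (1 + s)) <= 1 + s^-1.
Proof.
move=> s0; have sV : 0 < s^-1 by rewrite invr_gt0.
case: T => [|T]; first by rewrite big_geq //; lra.
(* The induction closes only with the tail of the comparison integral subtracted; the increment is
   then controlled by 1 + x <= e^x and [ln_succ_ge]. *)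
suff : \sum_(1 <= t < T.+2) t%:R `^ (- (1 + s))
    <= 1 + s^-1 * (1 - T.+1%:R `^ (- s)).
  move/le_trans; apply; rewrite lerD2l mulrBr mulr1 gerBl.
  by rewrite mulr_ge0 ?powR_ge0 // ltW.
elim: T => [|T IH]; first by rewrite big_nat1 !powR1 subrr mulr0 addr0.
rewrite big_nat_recr //=.
have T2 : (0 : R) < T.+2%:R by rewrite ltr0n.
apply: le_trans (lerD IH (lexx _)) _.
have -> : (T.+2%:R : R) `^ (- (1 + s)) = T.+2%:R^-1 * T.+2%:R `^ (- s).
  by rewrite opprD powRD ?powR_inv1 ?(ltW T2) // (gt_eqF T2) implybT.
have H : (T.+2%:R : R) `^ (- s) * (1 + s * T.+2%:R^-1) <= T.+1%:R `^ (- s).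
  apply: le_trans (ler_wpM2l (powR_ge0 _ _) (expR_ge1Dx _)) _.
  rewrite !powR_expR ?ltr0n // -expRD ler_expR.
  have := ler_wpM2l (ltW s0) (@ln_succ_ge T.+1 isT).
  move: (T.+2%:R^-1) (ln T.+1%:R) (ln T.+2%:R) => V a b; lra.
have /(ler_wpM2l (ltW sV)) : s * T.+2%:R^-1 * T.+2%:R `^ (- s) <=
    T.+1%:R `^ (- s) - T.+2%:R `^ (- s).
  move: H; rewrite mulrDr mulr1 -lerBrDl; apply: le_trans.
  by rewrite mulrC.
rewrite !mulrA mulVf ?gt_eqF // mul1r => {}H.
rewrite -addrA lerD2l -lerBrDl -mulrBr.
by rewrite (_ : _ - _ - _ = T.+1%:R `^ (- s) - T.+2%:R `^ (- s)) //; ring.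
Qed.

End PowerSums.

(** * Consensus *)

Lemma sum_nat_shift_le (R : realType) (F : nat -> R) j l T : (j <= l)%N ->
  (forall t, 0 <= F t) ->
  \sum_(1 <= t < T.+1) F (t + j)%N <= \sum_(1 <= t < (T + l).+1) F t.
Proof.
move=> jl F0; have -> : \sum_(1 <= t < T.+1) F (t + j)%N =
    \sum_(1 + j <= t < (T + j).+1) F t by rewrite big_addn -addSn addnK.
rewrite (@big_cat_nat _ _ _ (1 + j)%N _ (T + l).+1) //=; try lia.
rewrite (@big_cat_nat _ _ _ (T + j).+1 (1 + j)%N (T + l).+1) //=; try lia.
by rewrite -[leLHS]add0r lerD ?sumr_ge0 // lerDl sumr_ge0.
Qed.

(** The first L terms cost at most L K, each later term is a contraction of the one L places
    earlier, and each [E t] lies in at most L windows. The contracted sum then moves to the left. *)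
Lemma sum_contraction (R : realType) (D E : nat -> R) (rho K : R) L T :
  0 <= rho < 1 -> 0 <= K -> (forall t, 0 <= D t) -> (forall t, 0 <= E t) ->
  (forall t, (1 <= t)%N -> D t <= K) ->
  (forall t, (1 <= t)%N ->
     D (t + L)%N <= rho * D t + 2 * \sum_(j < L) E (t + j)%N) ->
  (1 - rho) * \sum_(1 <= t < T.+1) D t
    <= L%:R * K + 2 * L%:R * \sum_(1 <= t < T.+1) E t.
Proof.
move=> /andP[rho0 rho1] K0 D0 E0 DK DL.
have sumE0 T' : 0 <= \sum_(1 <= t < T'.+1) E t by apply: sumr_ge0.
have sumD0 T' : 0 <= \sum_(1 <= t < T'.+1) D t by apply: sumr_ge0.
have headD T' : \sum_(1 <= t < T'.+1) D t <= T'%:R * K.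
  rewrite mulr_natl -[X in K *+ X](subn0 T') -subSS -sumr_const_nat.
  by rewrite ler_sum_nat // => t /andP[]; eauto.
have [TL|LT] := leqP T L.
  apply: (@le_trans _ _ (L%:R * K)); last by rewrite lerDl !mulr_ge0.
  have : T%:R * K <= L%:R * K by rewrite ler_wpM2r // ler_nat.
  have := sumD0 T; have := headD T; nra.
rewrite -(subnK (ltnW LT)); set T' := (T - L)%N.
have split_sum : \sum_(1 <= t < (T' + L).+1) D t =
    \sum_(1 <= t < L.+1) D t + \sum_(1 <= t < T'.+1) D (t + L)%N.
  rewrite (@big_cat_nat _ _ _ L.+1) //=; last by lia.
  by rewrite -[in X in _ + X = _](addn1 L) addnC big_addn -addSn addnK.
have monoD : \sum_(1 <= t < T'.+1) D t <= \sum_(1 <= t < (T' + L).+1) D t.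
  have := @sum_nat_shift_le R D 0 L T' isT D0.
  by under eq_bigr do rewrite addn0.
have contr : \sum_(1 <= t < T'.+1) D (t + L)%N <=
    rho * \sum_(1 <= t < T'.+1) D t
    + 2 * L%:R * \sum_(1 <= t < (T' + L).+1) E t.
  apply: (@le_trans _ _ (\sum_(1 <= t < T'.+1)
      (rho * D t + 2 * \sum_(j < L) E (t + j)%N))).
    by rewrite ler_sum_nat // => t /andP[]; eauto.
  rewrite big_split /= -!mulr_sumr lerD2l -mulrA ler_pM2l //.
  rewrite exchange_big /= mulr_natl -[X in _ *+ X]card_ord -sumr_const.
  by apply: ler_sum => j _; apply: sum_nat_shift_le => //; exact: ltnW.
have := ler_wpM2l rho0 monoD; have := headD L; have := split_sum; lra.
Qed.

Section Consensus.
Context {R : realType} {n : nat}.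
Variables (E : nat -> rel 'I_n) (W : nat -> 'M[R]_n) (w : R) (B : nat).
Hypotheses (HW : mixing E W) (A2 : assumption2 E W w B).

Let w_gt0 : 0 < w. Proof. by have /andP[] := a2_w A2. Qed.
Let w_lt1 : w < 1. Proof. by have /andP[] := a2_w A2. Qed.
Let W_ge0 t i j : (1 <= t)%N -> 0 <= W t i j.
Proof. by move=> t1; have [] := a2_W_ds A2 t1. Qed.
Let W_row t i : (1 <= t)%N -> \sum_j W t i j = 1.
Proof. by move=> t1; have [] := a2_W_ds A2 t1. Qed.

(** The product W_{t+k-1} ... W_t, latest factor on the left: the weights that k averaging steps
    starting at time t give to the initial points. *)
Fixpoint transition (t k : nat) : 'M[R]_n :=
  if k is k'.+1 then W (t + k') *m transition t k' else 1%:M.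

Lemma transition_ge0 t k i j : (1 <= t)%N -> 0 <= transition t k i j.
Proof.
move=> t1; elim: k i j => [|k IH] i j /=; first by rewrite mxE ler0n.
by rewrite mxE sumr_ge0 // => a _; rewrite mulr_ge0 ?W_ge0 // ltn_addr.
Qed.

Lemma transition_row t k i : (1 <= t)%N -> \sum_j transition t k i j = 1.
Proof.
move=> t1; elim: k i => [|k IH] i /=.
  rewrite (bigD1 i) //= mxE eqxx big1 ?addr0 // => j /negPf ji.
  by rewrite mxE eq_sym ji.
under eq_bigr do rewrite mxE.
rewrite exchange_big /= -[RHS](@W_row (t + k)%N i) ?ltn_addr //.
by apply: eq_bigr => a _; rewrite -mulr_sumr IH mulr1.
Qed.

(** An edge or a self-loop carries weight at least w, so prolonging a walk by one step costs one
    factor w. *)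
Lemma transition_step t k a i j : (1 <= t)%N ->
  w ^+ k <= transition t k a j -> E (t + k) a i || (i == a) ->
  w ^+ k.+1 <= transition t k.+1 i j.
Proof.
move=> t1 wa Eai; have tk1 : (1 <= t + k)%N by rewrite ltn_addr.
have Wia := a2_W_lb A2 tk1 ((HW i a tk1).1 Eai).
rewrite /= mxE (bigD1 a) //= exprS; apply: (@le_trans _ _
  (W (t + k) i a * transition t k a j)).
  by rewrite ler_pM // ?exprn_ge0 // ltW.
by rewrite lerDl sumr_ge0 // => b _; rewrite mulr_ge0 ?W_ge0 ?transition_ge0.
Qed.

(* The agents reached from j keep being reached, because of the self-loops, and
   strong connectivity adds one to their number in each block of B steps. *)
Lemma transition_lb t i j : (1 <= t)%N ->
  w ^+ (n * B) <= transition t (n * B) i j.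
Proof.
move=> t1; pose S k := [set i | w ^+ k <= transition t k i j]%SET.
have Sj k : j \in S k.
  elim: k => [|k IH]; first by rewrite inE /= mxE eqxx expr0.
  rewrite inE; apply: (transition_step t1 (a := j)); last by rewrite eqxx orbT.
  by move: IH; rewrite inE.
have Smono k l : (k <= l)%N -> S k \subset S l.
  move=> /subnK <-; elim: (l - k)%N => // d IH; apply: (fintype.subset_trans IH).
  apply/fintype.subsetP => a; rewrite !inE addSn => ak.
  by apply: (transition_step t1 ak); rewrite eqxx orbT.
have Sgrow k : S (k + B)%N \subset S k -> S k = [set: 'I_n]%SET.
  move=> SB; apply/finset.setP => b; rewrite finset.in_setT.
  have tk1 : (1 <= t + k)%N by rewrite ltn_addr.
  have := a2_connected A2 tk1 j b => /connectP[pth pthP bE].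
  set r := (X in path X) in pthP.
  suff walk a : a \in S k -> path r a pth -> last a pth \in S k.
    by rewrite bE walk.
  elim: pth {bE pthP} a => //= c pth IH a Sa /andP[/existsP[l El]]; apply: IH.
  apply: (fintype.subsetP SB); apply: (fintype.subsetP (Smono (k + l).+1 _ _)).
    by rewrite ltn_add2l.
  rewrite inE; apply: (transition_step t1 (a := a)).
    by have := fintype.subsetP (Smono k (k + l)%N (leq_addr _ _)) _ Sa; rewrite inE.
  by rewrite addnA El.
have card_S c : (minn c.+1 n <= #|S (c * B)%N|)%N.
  elim: c => [|c IH].
    rewrite mul0n (leq_trans (geq_minl _ _)) //.
    by rewrite card_gt0; apply/set0Pn; exists j.
  have [SB|] := boolP (S (c * B + B)%N \subset S (c * B)%N).
    rewrite mulSn addnC (eqP (_ : S (c * B + B)%N == [set: 'I_n]%SET)).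
      by rewrite cardsT card_ord geq_minr.
    by rewrite -finset.subTset -(Sgrow _ SB) Smono // leq_addr.
  move=> nSB; have : (#|S (c * B)%N| < #|S (c.+1 * B)%N|)%N.
    apply: proper_card; rewrite properE mulSn addnC nSB andbT.
    by rewrite Smono // leq_addr.
  lia.
have : S (n * B)%N == [set: 'I_n]%SET.
  rewrite eqEcard finset.subsetT cardsT card_ord /=.
  by rewrite (leq_trans _ (card_S n)) // leq_min leqnSn leqnn.
by move=> /eqP/finset.setP/(_ i); rewrite !inE.
Qed.

(** * Averaging with perturbations *)

Context {p : nat}.
Variables (v e : 'I_n -> nat -> 'cV[R]_p).
Hypothesis v_step : forall i t, (1 <= t)%N ->
  v i t.+1 = \sum_(j < n) W t i j *: v j t + e i t.

Definition spread t : R :=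
  \big[Num.max/0]_(ij : 'I_n * 'I_n) enorm (v ij.1 t - v ij.2 t).

Lemma spread_ge0 t : 0 <= spread t.
Proof. exact: bigmax_ge_id. Qed.

Lemma dist_le_spread t i j : enorm (v i t - v j t) <= spread t.
Proof. by rewrite (le_trans _ (@le_bigmax _ _ _ _ _ (i, j))). Qed.

Lemma spread_le t K : 0 <= K ->
  (forall i j, enorm (v i t - v j t) <= K) -> spread t <= K.
Proof. by move=> K0 vK; apply: bigmax_le => // -[i j]. Qed.

(** Averaging with the non-negative rows of [W], which sum to 1, does not enlarge deviations, so the
    perturbations merely accumulate. *)
Lemma transition_unroll t k i : (1 <= t)%N ->
  enorm (v i (t + k)%N - \sum_j transition t k i j *: v j t)
    <= \sum_(l < k) \sum_j enorm (e j (t + l)%N).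
Proof.
move=> t1; elim: k i => [|k IH] i.
  rewrite big_ord0 addn0 (_ : _ - _ = 0) ?enorm0 //.
  rewrite (bigD1 i) //= mxE eqxx scale1r big1 ?addr0 ?subrr // => j.
  by rewrite eq_sym mxE => /negPf ->; rewrite scale0r.
have tk1 : (1 <= t + k)%N by rewrite ltn_addr.
rewrite addnS v_step // big_ord_recr /=.
have -> : \sum_j (W (t + k) *m transition t k) i j *: v j t =
    \sum_a W (t + k) i a *: \sum_j transition t k a j *: v j t.
  under eq_bigr do rewrite mxE scaler_suml.
  rewrite exchange_big; apply: eq_bigr => a _; rewrite scaler_sumr.
  by apply: eq_bigr => j _; rewrite scalerA.
rewrite addrAC -sumrB; apply: le_trans (ler_enormD _ _) _; apply: lerD; last first.
  by rewrite (bigD1 i) //= lerDl sumr_ge0.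
apply: le_trans (ler_enorm_sum _ _ _) _.
rewrite -[leRHS]mul1r -(W_row i tk1) mulr_suml ler_sum // => a _.
by rewrite -scalerBr enormZ ger0_norm ?W_ge0 // ler_wpM2l ?W_ge0.
Qed.

(* The difference of the two averages is the average of [v a t - v b t] over
   independent a and b; the pairs with a = b contribute nothing, and their
   weight is at least the square of [w ^+ (n * B)]. *)
Lemma transition_contract t i j : (1 <= t)%N ->
  enorm (\sum_a transition t (n * B) i a *: v a t
         - \sum_b transition t (n * B) j b *: v b t)
    <= (1 - w ^+ (n * B) ^+ 2) * spread t.
Proof.
move=> t1; set P := transition t (n * B); set d := w ^+ (n * B).
have P0 a b : 0 <= P a b by exact: transition_ge0.
have P1 a : \sum_b P a b = 1 by exact: transition_row.
have -> : \sum_a P i a *: v a t - \sum_b P j b *: v b t =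
    \sum_a \sum_b (P i a * P j b) *: (v a t - v b t).
  have -> : \sum_a P i a *: v a t = \sum_a \sum_b (P i a * P j b) *: v a t.
    apply: eq_bigr => a _.
    by rewrite -scaler_suml -mulr_sumr P1 mulr1.
  have -> : \sum_b P j b *: v b t = \sum_a \sum_b (P i a * P j b) *: v b t.
    rewrite exchange_big; apply: eq_bigr => b _ /=.
    by rewrite -scaler_suml -mulr_suml P1 mul1r.
  rewrite -sumrB; apply: eq_bigr => a _; rewrite -sumrB.
  by apply: eq_bigr => b _; rewrite scalerBr.
have termE a b : enorm ((P i a * P j b) *: (v a t - v b t)) =
    P i a * P j b * enorm (v a t - v b t).
  by rewrite enormZ ger0_norm ?mulr_ge0.
have sum1 : \sum_a \sum_b P i a * P j b = 1.
  by rewrite -[RHS](P1 i); apply: eq_bigr => a _; rewrite -mulr_sumr P1 mulr1.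
have diag_le : d ^+ 2 <= \sum_a \sum_b (P i a * P j b) *+ (a == b).
  apply: (@le_trans _ _ (P i i * P j i)).
    by rewrite expr2 ler_pM ?exprn_ge0 ?(ltW w_gt0) //; exact: transition_lb.
  rewrite (bigD1 i) //= (bigD1 i) //= eqxx mulr1n -addrA lerDl addr_ge0 //.
    by apply: sumr_ge0 => b _; rewrite mulrn_wge0 // mulr_ge0.
  by apply: sumr_ge0 => a _; apply: sumr_ge0 => b _; rewrite mulrn_wge0 ?mulr_ge0.
apply: (@le_trans _ _ (\sum_a \sum_b
    (P i a * P j b - (P i a * P j b) *+ (a == b)) * spread t)).
  apply: le_trans (ler_enorm_sum _ _ _) _; apply: ler_sum => a _.
  apply: le_trans (ler_enorm_sum _ _ _) _; apply: ler_sum => b _.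
  rewrite termE; case: eqVneq => [->|_].
    by rewrite subrr enorm0 mulr1n subrr mulr0 mul0r.
  by rewrite mulr0n subr0 ler_wpM2l ?mulr_ge0 ?dist_le_spread.
under eq_bigr do rewrite -mulr_suml.
rewrite -mulr_suml ler_wpM2r ?spread_ge0 //.
under eq_bigr do rewrite sumrB.
by rewrite sumrB sum1 lerD2l lerN2.
Qed.

(** Two agents are compared through their unperturbed averages, which contract; each of the two
    deviates from its average by at most the accumulated perturbation, whence the factor 2. *)
Lemma spread_contract t : (1 <= t)%N ->
  spread (t + n * B) <= (1 - w ^+ (n * B) ^+ 2) * spread t
    + 2 * \sum_(l < n * B) \sum_j enorm (e j (t + l)%N).
Proof.
move=> t1; set S := \sum_(l < _) _.
have S0 : 0 <= S by apply: sumr_ge0 => l _; apply: sumr_ge0.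
apply: spread_le => [|i j].
  rewrite addr_ge0 ?mulr_ge0 ?spread_ge0 // subr_ge0 exprn_ile1 ?exprn_ge0 //.
    exact: ltW.
  by rewrite exprn_ile1 ?ltW.
have hi := transition_unroll (n * B) i t1; have hj := transition_unroll (n * B) j t1.
have hij := transition_contract i j t1.
set a := \sum_j _ *: _ in hi; set b := \sum_j _ *: _ in hj.
have h1 := ler_enorm_dist a (v i (t + n * B)%N) (v j (t + n * B)%N).
have h2 := ler_enorm_dist b a (v j (t + n * B)%N).
rewrite (enorm_distC b) in h2.
rewrite -/a -/b in hij.
move: hi hj hij h1 h2; rewrite -/S; lra.
Qed.

Lemma sum_spread_le K T : 0 <= K ->
  (forall t, (1 <= t)%N -> spread t <= K) ->
  w ^+ (n * B) ^+ 2 * \sum_(1 <= t < T.+1) spread t <=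
  (n * B)%:R * K + 2 * (n * B)%:R * \sum_(1 <= t < T.+1) \sum_i enorm (e i t).
Proof.
move=> K0 spreadK; set d := w ^+ (n * B) ^+ 2.
have d0 : 0 < d by rewrite !exprn_gt0.
have d1 : d <= 1 by rewrite !exprn_ile1 ?exprn_ge0 // ltW.
rewrite -[X in X * _](subKr 1); apply: sum_contraction => //.
- by rewrite subr_ge0 d1 gtrBl.
- exact: spread_ge0.
- by move=> t; apply: sumr_ge0.
- exact: spread_contract.
Qed.

End Consensus.

(** * The algorithm *)

Section StackedVectors.
Context {R : realType} {n : nat} {m : 'I_n -> nat}.
Variable v : forall i : 'I_n, 'cV[R]_(m i).

Lemma mxcol_entry i k : (\mxcol_i v i) (tagnat.Rank i k) 0 = v i k 0.
Proof.
by have /matrixP/(_ k 0) := mxcolK v i; rewrite mxE.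
Qed.

Lemma nonpos_mxcol : nonpos (\mxcol_i v i) -> forall i, nonpos (v i).
Proof. by move=> vneg i k; rewrite -mxcol_entry. Qed.

(** The Euclidean norm is at most the sum of absolute values; [tagnat.rank] identifies pairs (agent,
    coordinate) with indices of the stacked vector. *)
Lemma enorm_posmx_mxcol :
  enorm (posmx (\mxcol_i v i)) <= \sum_i \sum_(k < m i) Num.max (v i k 0) 0.
Proof.
apply: le_trans (enorm_le_sum_coord _) _.
rewrite (reindex tagnat.rank) /=; last exact/onW_bij/tagnat.rank_bij.
rewrite sig_big_dep /= le_eqVlt; apply/orP; left; apply/eqP.
apply: eq_bigr => -[i k] _ /=.
by rewrite posmxE tagnat.rankE mxcol_entry /= ger0_norm // le_max lexx orbT.
Qed.

End StackedVectors.

(** * Positive parts and their subgradients *)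

Section PositivePart.
Context {R : realType}.

Lemma posmx_coord_ge0 k (v : 'cV[R]_k) j : 0 <= posmx v j 0.
Proof. by rewrite posmxE le_max lexx orbT. Qed.

Lemma nonpos_posmx k (v : 'cV[R]_k) : nonpos v -> posmx v = 0.
Proof.
move=> v0; apply/matrixP => i j; rewrite (ord1 j) posmxE mxE.
by rewrite max_r.
Qed.

Lemma edot_ge0 k (u v : 'cV[R]_k) : (forall j, 0 <= u j 0) ->
  (forall j, 0 <= v j 0) -> 0 <= edot u v.
Proof. by move=> u0 v0; apply: sumr_ge0 => j _; rewrite mulr_ge0. Qed.

Lemma col_pos_subgradient_enorm_le k l (v : 'cV[R]_l) (G D : 'M[R]_(k, l)) j :
  is_pos_subgradient v G D -> enorm (col j D) <= enorm (col j G).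
Proof.
move=> /(_ j)[s [/andP[s0 s1] _ _ ->]].
by rewrite enormZ ger0_norm // ler_piMl.
Qed.

(** With s the multiplier of the column, [h(x)]_+ = s h(x), while s h(y) <= [h(y)]_+ since s lies in
    [0, 1]; the subgradient inequality scaled by s links the two. *)
Lemma pos_subgradient_ineq k l (X : set 'cV[R]_k) (h : 'cV[R]_k -> 'cV[R]_l)
    (x y : 'cV[R]_k) (G D : 'M[R]_(k, l)) j :
  is_subgradient X (fun u => h u j 0) x (col j G) ->
  is_pos_subgradient (h x) G D -> X y ->
  posmx (h x) j 0 + (D^T *m (y - x)) j 0 <= posmx (h y) j 0.
Proof.
move=> Gsub /(_ j)[s [/andP[s0 s1] sP sN DE]] /Gsub Gh.
rewrite tr_mulmx_edot DE edotZl !posmxE.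
have -> : Num.max (h x j 0) 0 = s * h x j 0.
  case: ltgtP => [hx|hx|->]; [by rewrite sN // mul0r| |by rewrite mulr0].
  by rewrite sP // mul1r.
rewrite -mulrDr (le_trans (ler_wpM2l s0 Gh)) //.
have [hy|hy] := leP (h y j 0) 0; first by rewrite mulr_ge0_le0.
by rewrite ler_piMl // ltW.
Qed.

Lemma enorm_tr_mulmx_le k l (D : 'M[R]_(k, l)) (v : 'cV[R]_k) c :
  (forall j, enorm (col j D) <= c) -> enorm (D^T *m v) <= l%:R * c * enorm v.
Proof.
move=> Dc; apply: le_trans (enorm_le_sum_coord _) _.
rewrite -mulrA mulr_natl -[X in _ *+ X]card_ord -sumr_const.
apply: ler_sum => j _; rewrite tr_mulmx_edot.
by rewrite (le_trans (norm_edot_le _ _)) // ler_wpM2r.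
Qed.

End PositivePart.

(** * Telescoping sums with varying weights *)

Section WeightedTelescopes.
Context {R : realType}.
Implicit Types (a b c V Q : nat -> R) (T : nat).

(* [V t] stands for the distance of the iterate to the comparator at time t,
   [V' t] for the distance of the next iterate to the same comparator. *)
Lemma weighted_telescope_le a V V' c K T :
  (forall t, (1 <= t)%N -> 0 <= a t <= a t.+1) ->
  (forall t, (1 <= t <= T)%N -> 0 <= V t <= K /\ 0 <= V' t <= K) ->
  (forall t, 0 <= c t) ->
  (forall t, (1 <= t < T)%N -> V t.+1 <= V' t + c t) -> (0 < T)%N ->
  \sum_(1 <= t < T.+1) a t.+1 * (V t - V' t)
    <= a T.+1 * (K + \sum_(1 <= t < T) c t).
Proof.
move=> a_mono VK c0 Vc T0.
(* The retained [- V' S] cancels the next [V], once the weight of the non-negative bracket has been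
   raised to the next one. *)
suff H S : (0 < S <= T)%N -> \sum_(1 <= t < S.+1) a t.+1 * (V t - V' t)
    <= a S.+1 * (K + \sum_(1 <= t < S) c t - V' S).
  have /andP[a0 aT] := a_mono _ T0.
  have [_ /andP[V0 _]] := VK T (introT andP (conj T0 (leqnn T))).
  rewrite (le_trans (H T _)) ?T0 //= ler_wpM2l //; first exact: le_trans aT.
  by rewrite gerBl.
elim: S => // -[|S] IH /andP[_ ST].
  have [/andP[V0 VK1] _] := VK 1%N ST.
  have /andP[a1 a2] := a_mono 1%N isT.
  rewrite big_nat1 big_geq // addr0 ler_wpM2l ?(le_trans a1) // lerD2r //.
rewrite big_nat_recr //= [in leRHS]big_nat_recr //=.
have /andP[a2 a3] := a_mono S.+2 isT.
have /andP[a1 _] := a_mono S.+1 isT.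
have ST' : (0 < S.+1 <= T)%N by exact: ltnW ST.
have := IH ST'; set sV := \sum_(_ <= _ < _) _ => hV.
have := Vc S.+1 ST; set sC := \sum_(_ <= _ < _) _ in hV *.
have [_ /andP[_ hV']] := VK S.+1 ST'.
have sC0 : 0 <= sC by apply: sumr_ge0.
have c0' := c0 S.+1.
move=> hc.
have : (a S.+3 - a S.+2) * (K + sC - V' S.+1) >= 0.
  by rewrite mulr_ge0 ?subr_ge0 //; lra.
have : a S.+3 * (V' S.+1 + c S.+1 - V S.+2) >= 0.
  by rewrite mulr_ge0 ?subr_ge0 // (le_trans a2).
move: hV; nra.
Qed.

(** Summation by parts: the weight increments consume at most half of the [b] terms, and the other
    half survives. *)
Lemma dual_telescope_ge a b Q T :
  (forall t, 0 <= Q t) -> Q 1%N = 0 ->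
  (forall t, (1 <= t)%N -> a t.+1 - a t <= b t.+1 / 2) ->
  a T.+1 * Q T.+1 + 2^-1 * (\sum_(1 <= t < T.+1) b t.+1 * Q t)
   <= \sum_(1 <= t < T.+1) (a t.+1 * (Q t.+1 - Q t) + b t.+1 * Q t).
Proof.
move=> Q0 Q1 ab; elim: T => [|T IH].
  by rewrite !big_geq // Q1 !mulr0 addr0.
rewrite !(@big_nat_recr _ _ _ T.+1) //=.
apply: le_trans (lerD IH (lexx _)).
case: T {IH} => [|T]; first by rewrite !big_geq // Q1; lra.
by have := ler_wpM2r (Q0 T.+2) (ab T.+2 isT); lra.
Qed.

Lemma increment_telescope_le a Q T :
  (forall t, 0 <= Q t) -> Q 1%N = 0 ->
  (forall t, (1 <= t)%N -> a t <= a t.+1) ->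
  \sum_(1 <= t < T.+1) a t.+1 * (Q t.+1 - Q t) <= a T.+1 * Q T.+1.
Proof.
move=> Q0 Q1 amono; elim: T => [|T IH]; first by rewrite big_geq // Q1 mulr0.
rewrite big_nat_recr //=; apply: le_trans (lerD IH (lexx _)) _.
case: T {IH} => [|T]; first by rewrite Q1; lra.
by have := ler_wpM2r (Q0 T.+2) (amono T.+2 isT); lra.
Qed.

End WeightedTelescopes.

(** * One step of the primal and dual iterations *)

Section Algorithm.
Context {R : realType} {n p : nat} {m : 'I_n -> nat}.
Variables (X : set 'cV[R]_p) (f : 'I_n -> nat -> 'cV[R]_p -> R).
Variable g : forall i : 'I_n, nat -> 'cV[R]_p -> 'cV[R]_(m i).
Variable df : 'I_n -> nat -> 'cV[R]_p -> 'cV[R]_p.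
Variables dg dgpos : forall i : 'I_n, nat -> 'cV[R]_p -> 'M[R]_(p, m i).
Variables (E : nat -> rel 'I_n) (W : nat -> 'M[R]_n).
Variables (RX F1 F2 w : R) (B : nat) (alpha beta gamma tau : nat -> R).
Hypotheses (HW : mixing E W) (A1 : assumption1 X f g df dg dgpos RX F1 F2).
Hypotheses (A2 : assumption2 E W w B) (A3 : assumption3 tau).
Hypothesis alpha_gt0 : forall t, (1 <= t)%N -> 0 < alpha t.
Hypothesis alpha_noninc : forall t, (1 <= t)%N -> alpha t.+1 <= alpha t.
Hypothesis beta_gt0 : forall t, (1 <= t)%N -> 0 < beta t.
Hypothesis beta_noninc : forall t, (1 <= t)%N -> beta t.+1 <= beta t.
Hypothesis gamma_gt0 : forall t, (1 <= t)%N -> 0 < gamma t.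
Hypothesis gamma_noninc : forall t, (1 <= t)%N -> gamma t.+1 <= gamma t.
Hypothesis beta_gamma_le1 : forall t, (1 <= t)%N ->
  beta t.+1 * gamma t.+1 <= 1.
Hypothesis gammaV_incr : forall t, (1 <= t)%N ->
  (gamma t.+1)^-1 - (gamma t)^-1 <= beta t.+1.
Hypothesis tau_ge0 : forall t, (1 <= t)%N -> 0 <= tau t.
Variables (x xhat z omega : 'I_n -> nat -> 'cV[R]_p).
Variable q : forall i : 'I_n, nat -> 'cV[R]_(m i).
Hypothesis alg : algorithm1 X g df dgpos W alpha beta gamma tau x xhat z omega q.

Let RX_gt0 : 0 < RX := a1_RX_gt0 A1.
Let F1_gt0 : 0 < F1 := a1_F1_gt0 A1.
Let F2_gt0 : 0 < F2 := a1_F2_gt0 A1.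

Definition ncons : nat := (\sum_i m i)%N.
(* Bounds the linearised constraint that drives the dual step. *)
Definition model_bound : R := F1 + ncons%:R * F2 * (2 * RX).
Local Notation cb := model_bound.

Lemma model_bound_ge0 : 0 <= cb.
Proof. by rewrite addr_ge0 ?mulr_ge0 // ltW. Qed.

Lemma iterate_proj i t : (1 <= t)%N ->
  is_eproj X (z i t.+1 - alpha t.+1 *: omega i t.+1) (x i t.+1).
Proof.
move=> t1; rewrite (alg_x alg i t1); apply: eprojP.
- by exists (x i 1%N); exact: alg_x1 alg i.
- exact: a1_X_closed A1.
- exact: a1_X_bounded A1.
Qed.

Lemma iterate_in i t : (1 <= t)%N -> X (x i t).
Proof.
case: t => // -[_|t _]; first exact: alg_x1 alg i.
by have [] := @iterate_proj i t.+1 isT.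
Qed.

Lemma dist_in_le u v : X u -> X v -> enorm (u - v) <= 2 * RX.
Proof.
move=> /(a1_X_bounded A1) u_le /(a1_X_bounded A1) v_le.
by rewrite (le_trans (ler_enormB _ _)) // mulr_natl mulr2n lerD.
Qed.

Lemma trigger_in i t : (1 <= t)%N -> X (xhat i t).
Proof.
elim: t => // -[|t] IH _; first by rewrite (alg_xhat1 alg); exact: iterate_in.
rewrite (alg_xhat alg i (isT : (1 <= t.+1)%N)).
by case: ifP => _; [exact: iterate_in|exact: IH].
Qed.

Lemma trigger_dist i t : (1 <= t)%N -> enorm (x i t - xhat i t) <= tau t.
Proof.
case: t => // -[_|t _]; first by rewrite (alg_xhat1 alg) subrr enorm0 tau_ge0.
rewrite (alg_xhat alg i (isT : (1 <= t.+1)%N)); case: ifP => [_|/negbT].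
  by rewrite subrr enorm0 tau_ge0.
by rewrite -ltNge => /ltW.
Qed.

(** Difference of squares: one factor is at most |u - v|, the sum of the distances at most 4 RX. *)
Lemma sqr_dist_diff_le u v y : X u -> X v -> X y ->
  enorm (u - y) ^+ 2 - enorm (v - y) ^+ 2 <= 4 * RX * enorm (u - v).
Proof.
move=> Xu Xv Xy.
have tri := ler_enorm_dist v u y.
have uy := dist_in_le Xu Xy; have vy := dist_in_le Xv Xy.
have := enorm_ge0 (u - y); have := enorm_ge0 (v - y).
have := enorm_ge0 (u - v).
move: (enorm (u - y)) (enorm (v - y)) (enorm (u - v)) tri uy vy => a b c *.
have [ab|ba] := leP a b.
  by apply: (@le_trans _ _ 0); [nra | rewrite !mulr_ge0 // ltW].
have : (a - b) * (a + b) <= c * (4 * RX) by rewrite ler_pM; lra.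
lra.
Qed.

Lemma dgpos_col_le i t k : (1 <= t)%N ->
  enorm (col k (dgpos i t (x i t))) <= F2.
Proof.
move=> t1; have Xx := iterate_in i t1.
apply: le_trans (col_pos_subgradient_enorm_le k (a1_dgpos A1 t1 Xx)) _.
exact: le_trans (enorm_col_le _ _) (a1_dg_bounded A1 i t1 Xx).
Qed.

Lemma dgpos_tr_coord_le i t k u : (1 <= t)%N ->
  `|((dgpos i t (x i t))^T *m u) k 0| <= F2 * enorm u.
Proof.
move=> t1; rewrite tr_mulmx_edot (le_trans (norm_edot_le _ _)) //.
by rewrite ler_wpM2r ?dgpos_col_le.
Qed.

(** First-order model of [g]_+ at the current iterate, evaluated at the next one; it is the input of
    the dual step. *)
Definition cons_model i t : 'cV[R]_(m i) :=
  posmx (g i t (x i t)) + (dgpos i t (x i t))^T *m (x i t.+1 - x i t).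

Lemma cons_model_le i t : (1 <= t)%N -> enorm (cons_model i t) <= cb.
Proof.
move=> t1; have Xx := iterate_in i t1.
have Xx' : X (x i t.+1) by exact: iterate_in.
rewrite (le_trans (ler_enormD _ _)) // lerD //.
  by rewrite (le_trans (enorm_posmx_le _)) // (a1_g_bounded A1).
rewrite (le_trans (enorm_tr_mulmx_le _ (fun k => dgpos_col_le k t1))) //.
rewrite ler_pM ?mulr_ge0 ?(ltW F2_gt0) // ?dist_in_le //.
rewrite ler_wpM2r ?(ltW F2_gt0) // ler_nat /ncons (bigD1 i) //=.
exact: leq_addr.
Qed.

Lemma dual_step i t : (1 <= t)%N -> q i t.+1 =
  posmx ((1 - beta t.+1 * gamma t.+1) *: q i t + gamma t.+1 *: cons_model i t).
Proof. exact: alg_q alg i t. Qed.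

Lemma dual_ge0 i t k : (1 <= t)%N -> 0 <= q i t k 0.
Proof.
case: t => // -[_|t _]; first by rewrite (alg_q1 alg) mxE.
by rewrite dual_step // posmx_coord_ge0.
Qed.

(** Before its positive part is taken, the new dual vector is a convex combination of q and of the
    model divided by beta, and |model| <= [cb]. As beta is non-increasing, the bound passes to the
    next index. *)
Lemma dual_bound i t : (1 <= t)%N -> beta t * enorm (q i t) <= cb.
Proof.
elim: t => // -[|t] IH _.
  by rewrite (alg_q1 alg) enorm0 mulr0 model_bound_ge0.
have {}IH := IH isT; rewrite dual_step //.
have b0 := @beta_gt0 t.+2 isT; have g0 := @gamma_gt0 t.+2 isT.
have bg := @beta_gamma_le1 t.+1 isT.
apply: (@le_trans _ _ (beta t.+2 * ((1 - beta t.+2 * gamma t.+2) * enorm (q i t.+1)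
    + gamma t.+2 * cb))).
  rewrite ler_wpM2l ?(ltW b0) // (le_trans (enorm_posmx_le _)) //.
  rewrite (le_trans (ler_enormD _ _)) // !enormZ ger0_norm ?subr_ge0 //.
  by rewrite (gtr0_norm g0) lerD2l ler_wpM2l ?(ltW g0) // cons_model_le.
have : beta t.+2 * enorm (q i t.+1) <= cb.
  by apply: le_trans IH; rewrite ler_wpM2r // beta_noninc.
move: (enorm _) => Q hQ.
have : (1 - beta t.+2 * gamma t.+2) * (beta t.+2 * Q)
    <= (1 - beta t.+2 * gamma t.+2) * cb by rewrite ler_wpM2l ?subr_ge0.
lra.
Qed.

(** The positive part does not increase the norm. The rest is the square of q + gamma (model - beta
    q), whose last bracket has norm at most 2 [cb] by [dual_bound]. *)
Lemma dual_drift i t : (1 <= t)%N ->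
  enorm (q i t.+1) ^+ 2 <= enorm (q i t) ^+ 2
    + 2 * gamma t.+1 * (edot (q i t) (cons_model i t)
                        - beta t.+1 * enorm (q i t) ^+ 2)
    + gamma t.+1 ^+ 2 * (2 * cb) ^+ 2.
Proof.
move=> t1; rewrite dual_step // enorm_sqr.
apply: le_trans (edot_posmx_le _) _.
set u := q i t; set b := cons_model i t.
have -> : (1 - beta t.+1 * gamma t.+1) *: u + gamma t.+1 *: b =
    u + gamma t.+1 *: (b - beta t.+1 *: u).
  by rewrite scalerBl scale1r scalerBr scalerA (mulrC (gamma _)) addrAC addrA.
have db : enorm (b - beta t.+1 *: u) ^+ 2 <= (2 * cb) ^+ 2.
  rewrite ler_sqr ?nnegrE ?mulr_ge0 ?model_bound_ge0 //.
  rewrite (le_trans (ler_enormB _ _)) // mulr_natl mulr2n lerD ?cons_model_le //.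
  rewrite enormZ gtr0_norm ?beta_gt0 // (le_trans _ (dual_bound i t1)) //.
  by rewrite ler_wpM2r // beta_noninc.
have : gamma t.+1 ^+ 2 * enorm (b - beta t.+1 *: u) ^+ 2
    <= gamma t.+1 ^+ 2 * (2 * cb) ^+ 2 by rewrite ler_wpM2l ?sqr_ge0.
clearbody u b; rewrite !enorm_sqr !edotE (edotC b u); lra.
Qed.

Definition step_err i t : 'cV[R]_p := x i t.+1 - z i t.+1.

(** The obtuse-angle inequality at y, with the subgradient inequalities for losses and constraints
    and the expansion of |z_{t+1} - y|^2 around x_{t+1}. *)
Lemma primal_step i t y : (1 <= t)%N -> X y -> nonpos (g i t y) ->
  alpha t.+1 * (f i t (x i t) - f i t y + edot (q i t) (cons_model i t))
    + enorm (step_err i t) ^+ 2 / 2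
  <= alpha t.+1 * (F2 * enorm (x i t.+1 - x i t))
    + (enorm (z i t.+1 - y) ^+ 2 - enorm (x i t.+1 - y) ^+ 2) / 2.
Proof.
move=> t1 Xy gy; have Xx := iterate_in i t1.
have a0 := @alpha_gt0 t.+1 isT.
have obt := is_eproj_obtuse (a1_X_convex A1) (iterate_proj i t1) Xy.
set x' := x i t.+1 in obt *; set z' := z i t.+1 in obt *.
set D := dgpos i t (x i t).
(* The subgradient is taken at the old iterate, so ending at [x'] costs F2 times the step length. *)
have df_part : edot (df i t (x i t)) (y - x') <=
    f i t y - f i t (x i t) + F2 * enorm (x' - x i t).
  have -> : y - x' = (y - x i t) - (x' - x i t) by rewrite opprB addrA subrK.
  rewrite edotBr lerD //; last first.
    rewrite -edotNl; apply: le_trans (edot_le_enorm _ _) _.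
    by rewrite enormN ler_wpM2r // (a1_df_bounded A1).
  by have := a1_df A1 i t1 Xx Xy; rewrite lerBrDl.
(* In each coordinate the model at [x'] plus the linear term towards y is at most [g(y)]_+ = 0, and
   q has non-negative coordinates. *)
have dg_part : edot (D *m q i t) (y - x') <= - edot (q i t) (cons_model i t).
  rewrite edot_mulmx -subr_ge0 -opprD -edotDr oppr_ge0.
  rewrite -oppr_ge0 -edotNr; apply: edot_ge0 => k; first exact: dual_ge0.
  have := pos_subgradient_ineq (a1_dg A1 k t1 Xx) (a1_dgpos A1 t1 Xx) Xy.
  rewrite (nonpos_posmx gy) [leRHS]mxE -/D => Hk.
  rewrite mxE oppr_ge0; apply: le_trans Hk; rewrite /cons_model -/D -/x'.
  have -> : y - x i t = (y - x') + (x' - x i t) by rewrite addrA subrK.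
  have addE (u v : 'cV[R]_(m i)) : (u + v) k 0 = u k 0 + v k 0 by rewrite mxE.
  by rewrite (mulmxDr _ (y - x') (x' - x i t)) !addE; lra.
have -> : step_err i t = - (z' - x') by rewrite /step_err opprB.
rewrite enormN.
have om : edot (omega i t.+1) (y - x') <= f i t y - f i t (x i t)
    + F2 * enorm (x' - x i t) - edot (q i t) (cons_model i t).
  by rewrite (alg_omega alg i t1) edotDl; move: df_part dg_part; rewrite -/D; lra.
have {}om := ler_wpM2l (ltW a0) om.
have : enorm (z' - y) ^+ 2 = enorm (z' - x') ^+ 2 - 2 * edot (z' - x') (y - x')
    + enorm (x' - y) ^+ 2.
  have -> : z' - y = (z' - x') + (x' - y) by rewrite addrA subrK.
  rewrite -(opprB x' y) edotNr !enorm_sqr !(edotDl (z' - x')) !(edotDr (z' - x')).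
  by rewrite (edotC (x' - y)); ring.
have : edot (z' - alpha t.+1 *: omega i t.+1 - x') (y - x') =
    edot (z' - x') (y - x') - alpha t.+1 * edot (omega i t.+1) (y - x').
  by rewrite addrAC (edotBl (z' - x')) edotZl.
move: obt om; lra.
Qed.

(** [primal_step] divided by alpha plus [dual_drift] divided by 2 gamma; the inner product of q with
    the model cancels. *)
Lemma key_step i t y : (1 <= t)%N -> X y -> nonpos (g i t y) ->
  f i t (x i t) - f i t y
    + (gamma t.+1)^-1 / 2 * (enorm (q i t.+1) ^+ 2 - enorm (q i t) ^+ 2)
    + beta t.+1 * enorm (q i t) ^+ 2
    + (alpha t.+1)^-1 / 2 * enorm (step_err i t) ^+ 2
  <= 2 * cb ^+ 2 * gamma t.+1 + F2 * enorm (x i t.+1 - x i t)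
    + (alpha t.+1)^-1 / 2 *
      (enorm (z i t.+1 - y) ^+ 2 - enorm (x i t.+1 - y) ^+ 2).
Proof.
move=> t1 Xy gy; have prim := primal_step t1 Xy gy; have dual := dual_drift i t1.
have a0 := @alpha_gt0 t.+1 isT; have g0 := @gamma_gt0 t.+1 isT.
have aV0 : 0 < (alpha t.+1)^-1 by rewrite invr_gt0.
have gV0 : 0 < (gamma t.+1)^-1 by rewrite invr_gt0.
have aV : (alpha t.+1)^-1 * alpha t.+1 = 1 by rewrite mulVf ?gt_eqF.
have gV : (gamma t.+1)^-1 * gamma t.+1 = 1 by rewrite mulVf ?gt_eqF.
have {}prim := ler_wpM2l (ltW aV0) prim.
have {}dual := ler_wpM2l (ltW gV0) dual.
move: prim dual gV aV; move: (enorm (q i t.+1) ^+ 2) (enorm (q i t) ^+ 2).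
move: (edot _ _) (enorm (z i t.+1 - y) ^+ 2) (enorm (x i t.+1 - y) ^+ 2).
move: (enorm (step_err i t) ^+ 2) (enorm (x i t.+1 - x i t)) (f i t y).
move: (f i t (x i t)) (beta t.+1) (gamma t.+1) (gamma t.+1)^-1.
move: (alpha t.+1) (alpha t.+1)^-1 => al aV fx be ga gV s d fy e Z Y Q' Q.
move=> prim dual gVE aVE.
have primE : aV * (al * (fx - fy + e) + s / 2) =
    aV * al * (fx - fy + e) + aV / 2 * s by ring.
have primE' : aV * (al * (F2 * d) + (Z - Y) / 2) =
    aV * al * (F2 * d) + aV / 2 * (Z - Y) by ring.
have dualE : gV * (Q + 2 * ga * (e - be * Q) + ga ^+ 2 * (2 * cb) ^+ 2) =
    gV * Q + gV * ga * (2 * (e - be * Q)) + gV * ga * (ga * (4 * cb ^+ 2)).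
  by ring.
move: prim dual; rewrite primE primE' dualE gVE aVE !mul1r; lra.
Qed.

(** * Mixing, event triggering and the consensus error *)

Lemma sum_W_row t i : (1 <= t)%N -> \sum_j W t i j = 1.
Proof. by move=> t1; have [] := a2_W_ds A2 t1. Qed.

(** Row sums 1 allow Jensen's inequality, column sums 1 return the sum over agents; replacing
    broadcast points by iterates costs 4 RX tau per agent. *)
Lemma mix_sqr_dist t y : (1 <= t)%N -> X y ->
  \sum_i enorm (z i t.+1 - y) ^+ 2
    <= \sum_i enorm (x i t - y) ^+ 2 + n%:R * (4 * RX * tau t).
Proof.
move=> t1 Xy; have [W0 _ Wc] := a2_W_ds A2 t1.
apply: (@le_trans _ _ (\sum_i enorm (xhat i t - y) ^+ 2)).
  apply: (@le_trans _ _ (\sum_i \sum_j W t i j * enorm (xhat j t - y) ^+ 2)).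
    apply: ler_sum => i _.
    have -> : z i t.+1 - y = \sum_j W t i j *: (xhat j t - y).
      rewrite (alg_z alg i t1); under [RHS]eq_bigr do rewrite scalerBr.
      by rewrite sumrB -scaler_suml sum_W_row // scale1r.
    exact: enorm_convex_sqr (W0 i) (sum_W_row i t1).
  rewrite exchange_big ler_sum // => j _.
  by rewrite -mulr_suml Wc mul1r.
rewrite (natr_mul_sum n) -big_split /=.
apply: ler_sum => i _; rewrite -lerBlDl.
apply: le_trans (sqr_dist_diff_le (trigger_in i t1) (iterate_in i t1) Xy) _.
by rewrite ler_wpM2l ?mulr_ge0 ?(ltW RX_gt0) // enorm_distC trigger_dist.
Qed.

(** The path from x_{t+1} to x_t goes through z_{t+1}, which averages the broadcast points, and
    through the agent's own broadcast point. *)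
Lemma iterate_move_le i t : (1 <= t)%N ->
  enorm (x i t.+1 - x i t) <= enorm (step_err i t) + (spread xhat t + tau t).
Proof.
move=> t1; have [W0 Wr _] := a2_W_ds A2 t1.
apply: le_trans (ler_enorm_dist (z i t.+1) _ _) _; rewrite lerD2l.
apply: le_trans (ler_enorm_dist (xhat i t) _ _) _; apply: lerD; last first.
  by rewrite enorm_distC trigger_dist.
have -> : z i t.+1 - xhat i t = \sum_j W t i j *: (xhat j t - xhat i t).
  rewrite (alg_z alg i t1); under [RHS]eq_bigr do rewrite scalerBr.
  by rewrite sumrB -scaler_suml Wr scale1r.
apply: le_trans (ler_enorm_sum _ _ _) _.
rewrite -[leRHS]mul1r -(Wr i) mulr_suml ler_sum // => j _.
by rewrite enormZ ger0_norm // ler_wpM2l // dist_le_spread.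
Qed.

Lemma iterate_dist_le i j t : (1 <= t)%N ->
  enorm (x i t - x j t) <= spread xhat t + 2 * tau t.
Proof.
move=> t1; have := ler_enorm_dist (xhat i t) (x i t) (x j t).
have := ler_enorm_dist (xhat j t) (xhat i t) (x j t).
have := trigger_dist i t1; have := trigger_dist j t1.
have := dist_le_spread xhat t i j; rewrite (enorm_distC (x j t)); lra.
Qed.

Definition mixing_time : nat := (n * B)%N.
(** Twice the block length over the contraction gap, the factor left by [sum_spread_le]. *)
Definition spread_gain : R := 2 * mixing_time%:R / (w ^+ mixing_time ^+ 2).

Lemma spread_gain_ge0 : 0 <= spread_gain.
Proof.
have /andP[w0 _] := a2_w A2.
by rewrite divr_ge0 ?mulr_ge0 ?exprn_ge0 // ltW.
Qed.

(** The broadcast points follow the averaging recursion with perturbation xhat_{t+1} - z_{t+1},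
    which is at most the step error plus tau_{t+1} <= tau_t. *)
Lemma sum_spread_trigger_le T :
  \sum_(1 <= t < T.+1) spread xhat t <= spread_gain * (RX
    + (\sum_(1 <= t < T.+1) \sum_i enorm (step_err i t)
       + n%:R * \sum_(1 <= t < T.+1) tau t)).
Proof.
have /andP[w0 _] := a2_w A2.
have d0 : 0 < w ^+ mixing_time ^+ 2 by rewrite !exprn_gt0.
pose e i t := xhat i t.+1 - z i t.+1.
have e_step i t : (1 <= t)%N ->
    xhat i t.+1 = \sum_j W t i j *: xhat j t + e i t.
  by move=> t1; rewrite -(alg_z alg i t1) addrC subrK.
have e_le i t : (1 <= t)%N -> enorm (e i t) <= enorm (step_err i t) + tau t.
  move=> t1; have := ler_enorm_dist (x i t.+1) (xhat i t.+1) (z i t.+1).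
  have := @trigger_dist i t.+1 isT; have := A3 t1.
  rewrite -/(e i t) -/(step_err i t) (enorm_distC (xhat i t.+1)); lra.
have spread_le2 t : (1 <= t)%N -> spread xhat t <= 2 * RX.
  move=> t1; apply: spread_le => [|i j]; first by rewrite mulr_ge0 // ltW.
  by rewrite dist_in_le //; exact: trigger_in.
have K0 : 0 <= 2 * RX by rewrite mulr_ge0 // ltW.
have := sum_spread_le HW A2 e_step T K0 spread_le2.
rewrite -/mixing_time -ler_pdivlMl // => /le_trans; apply.
rewrite /spread_gain (mulrC (2 * _) _^-1) -[leRHS]mulrA ler_pM2l ?invr_gt0 //.
have : \sum_(1 <= t < T.+1) \sum_i enorm (e i t) <=
    \sum_(1 <= t < T.+1) \sum_i enorm (step_err i t)
    + n%:R * \sum_(1 <= t < T.+1) tau t.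
  rewrite mulr_sumr -big_split /= ler_sum_nat // => t /andP[t1 _].
  rewrite (natr_mul_sum n) -big_split /=.
  by apply: ler_sum => i _; exact: e_le.
move=> /(ler_wpM2l (_ : 0 <= 2 * mixing_time%:R)) H.
by rewrite mulrDr [leRHS]addrC [leLHS]addrC lerD ?H ?mulr_ge0 // mulrCA mulrA.
Qed.

(** * Energy inequalities summed over agents and time *)

Definition dual_energy t : R := \sum_i enorm (q i t) ^+ 2.
Definition err_energy t : R := \sum_i enorm (step_err i t) ^+ 2.
Definition comp_dist t y : R := \sum_i enorm (x i t - y) ^+ 2.
Definition total_move t : R := \sum_i enorm (x i t.+1 - x i t).

(** [mix_sqr_dist] trades z_{t+1} for x_t, so the same distance appears at consecutive times. *)
Lemma key_sum t y : (1 <= t)%N -> X y -> (forall i, nonpos (g i t y)) ->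
  \sum_i (f i t (x i t) - f i t y)
    + ((gamma t.+1)^-1 / 2 * (dual_energy t.+1 - dual_energy t)
       + beta t.+1 * dual_energy t)
    + (alpha t.+1)^-1 / 2 * err_energy t
  <= n%:R * (2 * cb ^+ 2 * gamma t.+1) + F2 * total_move t
    + (alpha t.+1)^-1 / 2 *
      (comp_dist t y - comp_dist t.+1 y + n%:R * (4 * RX * tau t)).
Proof.
move=> t1 Xy gy; have aV0 : 0 <= (alpha t.+1)^-1 / 2.
  by rewrite divr_ge0 // invr_ge0 ltW // alpha_gt0.
have key : \sum_i (f i t (x i t) - f i t y
    + (gamma t.+1)^-1 / 2 * (enorm (q i t.+1) ^+ 2 - enorm (q i t) ^+ 2)
    + beta t.+1 * enorm (q i t) ^+ 2
    + (alpha t.+1)^-1 / 2 * enorm (step_err i t) ^+ 2)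
  <= \sum_i (2 * cb ^+ 2 * gamma t.+1 + F2 * enorm (x i t.+1 - x i t)
    + (alpha t.+1)^-1 / 2 *
      (enorm (z i t.+1 - y) ^+ 2 - enorm (x i t.+1 - y) ^+ 2)).
  by apply: ler_sum => i _; exact: key_step.
move: key; rewrite !big_split /= -!mulr_sumr !sumrB sumr_const card_ord.
have := ler_wpM2l aV0 (mix_sqr_dist t1 Xy).
rewrite -/(dual_energy t) -/(dual_energy t.+1) -/(err_energy t).
rewrite -/(comp_dist t y) -/(comp_dist t.+1 y) -/(total_move t).
rewrite -(mulr_natl (gamma t.+1)).
by move: (_^-1) (\sum_i enorm (z _ _ - _) ^+ 2) => aV Z; lra.
Qed.

Lemma comp_dist_le t y : (1 <= t)%N -> X y ->
  0 <= comp_dist t y <= n%:R * (4 * RX ^+ 2).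
Proof.
move=> t1 Xy; apply/andP; split; first by apply: sumr_ge0 => i _; exact: sqr_ge0.
rewrite (natr_mul_sum n) ler_sum // => i _.
have -> : 4 * RX ^+ 2 = (2 * RX) ^+ 2 by ring.
rewrite ler_sqr ?nnegrE ?mulr_ge0 ?(ltW RX_gt0) //.
by rewrite dist_in_le //; exact: iterate_in.
Qed.

Lemma total_move_le t : (1 <= t)%N -> total_move t <= n%:R * (2 * RX).
Proof.
move=> t1; rewrite (natr_mul_sum n) ler_sum // => i _.
by rewrite dist_in_le //; exact: iterate_in.
Qed.

Lemma total_move_split t : (1 <= t)%N -> total_move t <=
  \sum_i enorm (step_err i t) + n%:R * (spread xhat t + tau t).
Proof.
move=> t1; rewrite (natr_mul_sum n) -big_split /=.
by apply: ler_sum => i _; exact: iterate_move_le.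
Qed.

Lemma sum_total_move_le T : \sum_(1 <= t < T.+1) total_move t <=
  \sum_(1 <= t < T.+1) \sum_i enorm (step_err i t)
  + n%:R * (\sum_(1 <= t < T.+1) spread xhat t + \sum_(1 <= t < T.+1) tau t).
Proof.
rewrite -big_split mulr_sumr -big_split /= ler_sum_nat // => t /andP[t1 _].
exact: total_move_split.
Qed.

Lemma dual_energy_ge0 t : 0 <= dual_energy t.
Proof. by apply: sumr_ge0 => i _; exact: sqr_ge0. Qed.

Lemma dual_energy1 : dual_energy 1 = 0.
Proof. by apply: big1 => i _; rewrite (alg_q1 alg) enorm0 expr0n. Qed.

Lemma gamma_le1 t : (1 <= t)%N -> gamma t <= gamma 1.
Proof.
elim: t => // -[|t] IH _ //.
exact: le_trans (@gamma_noninc t.+1 isT) (IH isT).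
Qed.

Lemma alphaV_mono t : (1 <= t)%N ->
  0 <= (alpha t)^-1 / 2 <= (alpha t.+1)^-1 / 2.
Proof.
move=> t1; have a0 := alpha_gt0 t1; have a1 := @alpha_gt0 t.+1 isT.
rewrite divr_ge0 ?invr_ge0 ?(ltW a0) //= ler_pM2r ?invr_gt0 //.
by rewrite lef_pV2 ?posrE // alpha_noninc.
Qed.

Lemma comp_dist_change t y y' : (1 <= t)%N -> X y -> X y' ->
  comp_dist t y' <= comp_dist t y + n%:R * (4 * RX * enorm (y' - y)).
Proof.
move=> t1 Xy Xy'.
rewrite (natr_mul_sum n) -big_split /=.
apply: ler_sum => i _; rewrite -lerBlDl !(enorm_distC (x i t)).
by apply: sqr_dist_diff_le => //; exact: iterate_in.
Qed.

(** Distances to the moving comparator telescope with weights 1 / (2 alpha), which produces the path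
    length; the dual drift telescopes with weights 1 / (2 gamma), at the price of half of the beta
    terms. *)
Lemma energy_le T (y : nat -> 'cV[R]_p) : (0 < T)%N ->
  (forall t, (1 <= t <= T)%N -> X (y t) /\ forall i, nonpos (g i t (y t))) ->
  \sum_(1 <= t < T.+1) \sum_i (f i t (x i t) - f i t (y t))
    + (gamma T.+1)^-1 / 2 * dual_energy T.+1
    + 2^-1 * (\sum_(1 <= t < T.+1) beta t.+1 * dual_energy t)
    + \sum_(1 <= t < T.+1) (alpha t.+1)^-1 / 2 * err_energy t
  <= n%:R * (2 * cb ^+ 2) * (\sum_(1 <= t < T.+1) gamma t.+1)
    + F2 * (\sum_(1 <= t < T.+1) total_move t)
    + (alpha T.+1)^-1 / 2 *
      (n%:R * (4 * RX ^+ 2) + n%:R * (4 * RX) * path_length T y)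
    + n%:R * (2 * RX) * \sum_(1 <= t < T.+1) (alpha t.+1)^-1 * tau t.
Proof.
move=> T0 Hy.
have key : \sum_(1 <= t < T.+1) (\sum_i (f i t (x i t) - f i t (y t))
    + ((gamma t.+1)^-1 / 2 * (dual_energy t.+1 - dual_energy t)
       + beta t.+1 * dual_energy t)
    + (alpha t.+1)^-1 / 2 * err_energy t)
  <= \sum_(1 <= t < T.+1) (n%:R * (2 * cb ^+ 2) * gamma t.+1
    + F2 * total_move t
    + (alpha t.+1)^-1 / 2 * (comp_dist t (y t) - comp_dist t.+1 (y t))
    + n%:R * (2 * RX) * ((alpha t.+1)^-1 * tau t)).
  rewrite ler_sum_nat // => t /andP[t1 tT].
  have [Xy gy] := Hy t (introT andP (conj t1 tT)).
  by apply: le_trans (key_sum t1 Xy gy) _; lra.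
rewrite !big_split /= -!mulr_sumr in key.
have tel : \sum_(1 <= t < T.+1) (alpha t.+1)^-1 / 2 *
      (comp_dist t (y t) - comp_dist t.+1 (y t)) <=
    (alpha T.+1)^-1 / 2 *
      (n%:R * (4 * RX ^+ 2) + n%:R * (4 * RX) * path_length T y).
  rewrite /path_length mulr_sumr.
  apply: (weighted_telescope_le (a := fun t => (alpha t)^-1 / 2)
    (V := fun t => comp_dist t (y t)) (V' := fun t => comp_dist t.+1 (y t))
    (c := fun t => n%:R * (4 * RX) * enorm (y t.+1 - y t))) => //.
  - exact: alphaV_mono.
  - move=> t tT; have [Xy _] := Hy t tT; have /andP[t1 _] := tT.
    by split; exact: comp_dist_le.
  - by move=> t; rewrite !mulr_ge0 // ltW.
  - move=> t /andP[t1 tT]; rewrite -mulrA; apply: comp_dist_change => //.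
      by have [] := Hy t; rewrite ?t1 ?(ltnW tT).
    by have [] := Hy t.+1.
have dual : (gamma T.+1)^-1 / 2 * dual_energy T.+1
    + 2^-1 * (\sum_(1 <= t < T.+1) beta t.+1 * dual_energy t) <=
  \sum_(1 <= t < T.+1) ((gamma t.+1)^-1 / 2 * (dual_energy t.+1 - dual_energy t)
       + beta t.+1 * dual_energy t).
  apply: (dual_telescope_ge (a := fun t => (gamma t)^-1 / 2)).
  - exact: dual_energy_ge0.
  - exact: dual_energy1.
  - by move=> t t1; rewrite -mulrBl ler_pM2r ?invr_gt0 // gammaV_incr.
move: key tel dual; rewrite big_split /=; lra.
Qed.

(** Multiplying by alpha before summing gives the squared step errors a constant weight, and makes
    the distances to the fixed y telescope exactly. *)
Lemma err_energy_le T y : X y ->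
  (forall t, (1 <= t <= T)%N -> forall i, nonpos (g i t y)) ->
  \sum_(1 <= t < T.+1) err_energy t <=
    2 * (n%:R * (F1 + 2 * cb ^+ 2 * gamma 1 + F2 * (2 * RX)))
      * (\sum_(1 <= t < T.+1) alpha t.+1)
    + n%:R * (4 * RX ^+ 2) + n%:R * (4 * RX) * \sum_(1 <= t < T.+1) tau t.
Proof.
move=> Xy gy.
pose K := n%:R * (F1 + 2 * cb ^+ 2 * gamma 1 + F2 * (2 * RX)).
have key : \sum_(1 <= t < T.+1) ((alpha t.+1 * (gamma t.+1)^-1 / 2 *
        (dual_energy t.+1 - dual_energy t)
       + alpha t.+1 * beta t.+1 * dual_energy t)
    + 2^-1 * err_energy t)
  <= \sum_(1 <= t < T.+1) (K * alpha t.+1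
    - 2^-1 * (comp_dist t.+1 y - comp_dist t y)
    + 2^-1 * (n%:R * (4 * RX)) * tau t).
  rewrite ler_sum_nat // => t /andP[t1 tT].
  have a0 := @alpha_gt0 t.+1 isT.
  have := ler_wpM2l (ltW a0) (key_sum t1 Xy (gy t (introT andP (conj t1 tT)))).
  have aV : alpha t.+1 * (alpha t.+1)^-1 = 1 by rewrite divff ?gt_eqF.
  have fF : - (n%:R * F1) <= \sum_i (f i t (x i t) - f i t y).
    rewrite -mulrN (natr_mul_sum n) ler_sum // => i _.
    have := a1_f_bounded A1 i t1 (iterate_in i t1) Xy.
    by rewrite ler_norml => /andP[].
  have {}fF := ler_wpM2l (ltW a0) fF.
  have mv := ler_wpM2l (ltW a0) (ler_wpM2l (ltW F2_gt0) (total_move_le t1)).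
  have gm := ler_wpM2l (ltW a0) (ler_wpM2l (_ : 0 <= n%:R * (2 * cb ^+ 2))
    (@gamma_le1 t.+1 isT)).
  have {}gm := gm (mulr_ge0 (ler0n _ _) (mulr_ge0 (ler0n _ 2) (sqr_ge0 cb))).
  move: fF mv gm aV; rewrite /K; move: (\sum_i (_ - _)) (total_move t).
  move: (comp_dist t y) (comp_dist t.+1 y) (err_energy t) (tau t).
  move: (dual_energy t.+1) (dual_energy t) (beta t.+1) (gamma t.+1)^-1.
  move: (gamma t.+1) (gamma 1) (cb ^+ 2) (alpha t.+1) (alpha t.+1)^-1.
  move=> ga g1 c2 al aV Q' Q be gV V V' S ta F mv hF hmv hg alV.
  have -> : al * (F + (gV / 2 * (Q' - Q) + be * Q) + aV / 2 * S) =
    al * F + (al * gV / 2 * (Q' - Q) + al * be * Q) + al * aV * (2^-1 * S).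
    by ring.
  have -> : al * (n%:R * (2 * c2 * ga) + F2 * mv +
      aV / 2 * (V - V' + n%:R * (4 * RX * ta))) =
    al * (n%:R * (2 * c2) * ga) + al * (F2 * mv) +
      al * aV * (2^-1 * (V - V' + n%:R * (4 * RX * ta))) by ring.
  rewrite alV !mul1r; lra.
rewrite !big_split /= sumrN -!mulr_sumr telescope_sumr // in key.
(* The weights alpha / (2 gamma) still grow by at most alpha beta / 2, because alpha is
   non-increasing. *)
have dual : 0 <= \sum_(1 <= t < T.+1) (alpha t.+1 * (gamma t.+1)^-1 / 2 *
        (dual_energy t.+1 - dual_energy t)
       + alpha t.+1 * beta t.+1 * dual_energy t).
  apply: le_trans (dual_telescope_ge (a := fun t => alpha t * (gamma t)^-1 / 2)
    (b := fun t => alpha t * beta t) T dual_energy_ge0 dual_energy1 _).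
    rewrite addr_ge0 //; last first.
      rewrite mulr_ge0 // big_nat sumr_ge0 // => t /andP[t1 _].
      by rewrite !mulr_ge0 ?dual_energy_ge0 // ltW // ?alpha_gt0 ?beta_gt0.
    rewrite mulr_ge0 ?dual_energy_ge0 // mulr_ge0 // mulr_ge0 ?invr_ge0 //;
      by rewrite ltW // ?alpha_gt0 ?gamma_gt0.
  move=> t t1; rewrite -mulrBl ler_pM2r ?invr_gt0 //.
  have a1 := @alpha_gt0 t.+1 isT; have g0 := gamma_gt0 t1.
  apply: le_trans (ler_wpM2l (ltW a1) (gammaV_incr t1)); rewrite mulrBr lerD2l lerN2.
  by rewrite ler_wpM2r ?invr_ge0 ?(ltW g0) // alpha_noninc.
have V1 : comp_dist 1 y <= n%:R * (4 * RX ^+ 2).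
  by have /andP[] := @comp_dist_le 1%N y isT Xy.
have VT : 0 <= comp_dist T.+1 y.
  by have /andP[] := @comp_dist_le T.+1 y isT Xy.
move: key dual; rewrite big_split /= -/K; lra.
Qed.

(** * The regret bound *)

Lemma loss_transfer_le i j t : (1 <= t)%N ->
  f j t (x i t) <= f j t (x j t) + F2 * (spread xhat t + 2 * tau t).
Proof.
move=> t1; have Xi := iterate_in i t1; have Xj := iterate_in j t1.
have := a1_df A1 j t1 Xi Xj.
have := edot_le_enorm (df j t (x i t)) (x i t - x j t).
rewrite -(opprB (x i t)) edotNr.
have : enorm (df j t (x i t)) * enorm (x i t - x j t) <=
    F2 * (spread xhat t + 2 * tau t).
  by rewrite ler_pM ?iterate_dist_le // (a1_df_bounded A1).
lra.
Qed.

(** The regret evaluates every loss at every agent's iterate; moving each loss to its owner's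
    iterate costs F2 times the disagreement. *)
Lemma net_reg_decomp T y : (0 < n)%N -> n%:R * net_reg f x T y <=
  \sum_(1 <= t < T.+1) \sum_i (f i t (x i t) - f i t (y t))
  + n%:R * F2 * \sum_(1 <= t < T.+1) (spread xhat t + 2 * tau t).
Proof.
move=> n0; have nR : 0 < n%:R :> R by rewrite ltr0n.
rewrite /net_reg mulrBr mulrA divff ?gt_eqF // mul1r exchange_big /=.
rewrite !mulr_sumr -sumrB -big_split /= ler_sum_nat // => t /andP[t1 _].
rewrite /global_loss mulrA divff ?gt_eqF // mul1r sumrB addrAC lerD2r.
rewrite -mulr_sumr -(ler_pM2l nR) mulrA divff ?gt_eqF // mul1r mulrDr.
have le_i i : \sum_j f j t (x i t) <= \sum_j f j t (x j t) +
    n%:R * F2 * (spread xhat t + 2 * tau t).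
  rewrite -mulrA (natr_mul_sum n) -big_split /=.
  by apply: ler_sum => j _; exact: loss_transfer_le.
rewrite -mulrDr; move: (_ + _) le_i => S le_i.
by rewrite (natr_mul_sum n) ler_sum.
Qed.

(** Total coefficient of the step errors: F2 directly from the moves, and n F2 [spread_gain] twice,
    through the spread in the moves and in [net_reg_decomp]. *)
Definition err_weight : R := F2 * (1 + 2 * n%:R * spread_gain).

Lemma net_reg_le T y : (0 < n)%N -> (0 < T)%N -> feasible_seqs X g T y ->
  n%:R * net_reg f x T y <=
    n%:R * (2 * cb ^+ 2) * (\sum_(1 <= t < T.+1) gamma t.+1)
    + n%:R * (err_weight ^+ 2 / 2) * (\sum_(1 <= t < T.+1) alpha t.+1)
    + (alpha T.+1)^-1 / 2 *
      (n%:R * (4 * RX ^+ 2) + n%:R * (4 * RX) * path_length T y)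
    + n%:R * (2 * RX) * (\sum_(1 <= t < T.+1) (alpha t.+1)^-1 * tau t)
    + 2 * n%:R * F2 * spread_gain * RX
    + n%:R * (F2 * 2 + err_weight) * \sum_(1 <= t < T.+1) tau t.
Proof.
move=> n0 T0 Hy.
have en := energy_le T0 (fun t tT => conj (Hy t tT).1 (nonpos_mxcol (Hy t tT).2)).
have dec := net_reg_decomp T y n0.
have spr := sum_spread_trigger_le T.
have mv := sum_total_move_le T.
rewrite big_split /= -mulr_sumr in dec.
(* Young's inequality weighted by alpha: its quadratic part is exactly the error energy on the left
   of [energy_le]. *)
have young : err_weight * (\sum_(1 <= t < T.+1) \sum_i enorm (step_err i t)) <=
    \sum_(1 <= t < T.+1) (alpha t.+1)^-1 / 2 * err_energy t
    + n%:R * (err_weight ^+ 2 / 2) * (\sum_(1 <= t < T.+1) alpha t.+1).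
  rewrite !mulr_sumr -big_split /= ler_sum_nat // => t _.
  rewrite -(mulrA n%:R) (natr_mul_sum n) /err_energy !mulr_sumr -big_split.
  apply: ler_sum => i _ /=.
  have a0 := @alpha_gt0 t.+1 isT.
  have aV : (alpha t.+1)^-1 * alpha t.+1 = 1 by rewrite mulVf ?gt_eqF.
  have : 0 <= (alpha t.+1)^-1 / 2 *
      (enorm (step_err i t) - err_weight * alpha t.+1) ^+ 2.
    by rewrite mulr_ge0 ?sqr_ge0 // divr_ge0 // invr_ge0 ltW.
  move: (enorm _) (err_weight) (alpha t.+1) (alpha t.+1)^-1 aV => u k a b ba.
  have -> : b / 2 * (u - k * a) ^+ 2 =
    b / 2 * u ^+ 2 - (b * a) * (k * u) + (b * a) * (k ^+ 2 * a / 2) by field.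
  rewrite ba !mul1r; lra.
have dual1 : 0 <= (gamma T.+1)^-1 / 2 * dual_energy T.+1.
  by rewrite mulr_ge0 ?dual_energy_ge0 // divr_ge0 // invr_ge0 ltW // gamma_gt0.
have dual2 : 0 <= 2^-1 * (\sum_(1 <= t < T.+1) beta t.+1 * dual_energy t).
  rewrite mulr_ge0 // sumr_ge0 // => t _.
  by rewrite mulr_ge0 ?dual_energy_ge0 // ltW // beta_gt0.
have {}mv := ler_wpM2l (ltW F2_gt0) mv.
have {}spr := ler_wpM2l (_ : 0 <= 2 * n%:R * F2) spr.
have {}spr := spr (mulr_ge0 (mulr_ge0 (ler0n _ 2) (ler0n _ n)) (ltW F2_gt0)).
move: en dec spr mv young dual1 dual2.
rewrite /err_weight; lra.
Qed.

(* The dual step bounds the constraint value by a dual increment. *)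
Lemma sum_pos_constraint_le j k T :
  \sum_(1 <= t < T.+1) Num.max (g j t (x j t) k 0) 0 <=
    (gamma T.+1)^-1 * enorm (q j T.+1)
    + \sum_(1 <= t < T.+1) beta t.+1 * enorm (q j t)
    + F2 * \sum_(1 <= t < T.+1) enorm (x j t.+1 - x j t).
Proof.
(* Time 0 gets the value 0, since the dual variable is unconstrained there and the telescope asks
   for non-negativity at every index. *)
pose Q t := if t is 0%N then 0 else q j t k 0.
have Q0 t : 0 <= Q t by case: t => // t; exact: dual_ge0.
have gV0 t : (1 <= t)%N -> 0 < (gamma t)^-1.
  by move=> t1; rewrite invr_gt0 gamma_gt0.
have step : \sum_(1 <= t < T.+1) Num.max (g j t (x j t) k 0) 0 <=
  \sum_(1 <= t < T.+1) ((gamma t.+1)^-1 * (Q t.+1 - Q t) + beta t.+1 * enorm (q j t)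
     + F2 * enorm (x j t.+1 - x j t)).
  rewrite ler_sum_nat // => -[//|t] /andP[t1 _].
  have g0 := @gamma_gt0 t.+2 isT.
  have gV : (gamma t.+2)^-1 * gamma t.+2 = 1 by rewrite mulVf ?gt_eqF.
  have qle : q j t.+1 k 0 <= enorm (q j t.+1).
    exact: le_trans (ler_norm _) (coord_le_enorm _ _).
  have {}qle := ler_wpM2l (ltW (@beta_gt0 t.+2 isT)) qle.
  have bk : posmx (g j t.+1 (x j t.+1)) k 0 - F2 * enorm (x j t.+2 - x j t.+1)
      <= cons_model j t.+1 k 0.
    have := dgpos_tr_coord_le k (x j t.+2 - x j t.+1) t1.
    by rewrite ler_norml => /andP[H _]; rewrite [leRHS]mxE lerD2l.
  rewrite -posmxE; apply: le_trans (_ : cons_model j t.+1 k 0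
     + F2 * enorm (x j t.+2 - x j t.+1) <= _); first by lra.
  rewrite lerD2r.
  have : (1 - beta t.+2 * gamma t.+2) * q j t.+1 k 0
      + gamma t.+2 * cons_model j t.+1 k 0 <= Q t.+2.
    by rewrite /Q (dual_step j t1) posmxE le_max !mxE lexx.
  move/(ler_wpM2l (ltW (gV0 t.+2 isT))); rewrite /Q.
  move: qle gV; move: (gamma t.+2) (gamma t.+2)^-1.
  move: (cons_model _ _ _ _) (q j t.+2 k 0).
  move: (q j t.+1 k 0) (beta t.+2) (enorm (q j t.+1)) => u b e c u' ga v hu hv.
  have -> : v * ((1 - b * ga) * u + ga * c) =
    v * u - (v * ga) * (b * u) + (v * ga) * c by ring.
  rewrite hv !mul1r; lra.
apply: (le_trans step); rewrite !big_split /= -mulr_sumr !lerD2r.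
apply: (le_trans (increment_telescope_le (a := fun t => (gamma t)^-1) T Q0 _ _)).
- by rewrite /Q (alg_q1 alg) mxE.
- by move=> t t1; rewrite lef_pV2 ?posrE ?gamma_gt0 // gamma_noninc.
rewrite ler_wpM2l ?(ltW (gV0 _ _)) //.
exact: le_trans (ler_norm _) (coord_le_enorm _ _).
Qed.

(** * The constraint violation in terms of dual norms and step errors *)

Lemma constraint_transfer_le i j t k : (1 <= t)%N ->
  Num.max (g j t (x i t) k 0) 0 <=
  Num.max (g j t (x j t) k 0) 0 + F2 * (spread xhat t + 2 * tau t).
Proof.
move=> t1; have Xi := iterate_in i t1; have Xj := iterate_in j t1.
have s0 : 0 <= F2 * (spread xhat t + 2 * tau t).
  by rewrite mulr_ge0 ?(ltW F2_gt0) // (le_trans _ (iterate_dist_le i j t1)).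
rewrite ge_max; apply/andP; split; last by rewrite addr_ge0 // le_max lexx orbT.
apply: (@le_trans _ _ (g j t (x j t) k 0 + F2 * (spread xhat t + 2 * tau t))).
  have := a1_dg A1 k t1 Xi Xj.
  have := edot_le_enorm (col k (dg j t (x i t))) (x i t - x j t).
  rewrite -(opprB (x i t)) edotNr.
  have : enorm (col k (dg j t (x i t))) * enorm (x i t - x j t) <=
      F2 * (spread xhat t + 2 * tau t).
    rewrite ler_pM ?iterate_dist_le // (le_trans (enorm_col_le _ _)) //.
    exact: a1_dg_bounded A1 _ _ _ t1 Xi.
  lra.
by rewrite lerD2r le_max lexx.
Qed.

Definition dual_size t : R := \sum_i enorm (q i t).

(** Each constraint coordinate is moved to its owner's iterate. All coordinates of one agent share
    the same bound, and each m_j is at most [ncons]. *)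
Lemma net_ccv_decomp T : (0 < n)%N -> net_ccv g x T <=
  ncons%:R * ((gamma T.+1)^-1 * dual_size T.+1
    + (\sum_(1 <= t < T.+1) beta t.+1 * dual_size t)
    + F2 * (\sum_(1 <= t < T.+1) total_move t)
    + F2 * (\sum_(1 <= t < T.+1) (spread xhat t + 2 * tau t))).
Proof.
move=> n0; have nR : 0 < n%:R :> R by rewrite ltr0n.
pose s := F2 * \sum_(1 <= t < T.+1) (spread xhat t + 2 * tau t).
pose G := \sum_j \sum_(k < m j) \sum_(1 <= t < T.+1) Num.max (g j t (x j t) k 0) 0.
have row i : \sum_(1 <= t < T.+1) enorm (posmx (global_constraint g t (x i t)))
    <= G + ncons%:R * s.
  have sE : G + ncons%:R * s = \sum_(1 <= t < T.+1) \sum_j \sum_(k < m j)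
      (Num.max (g j t (x j t) k 0) 0 + F2 * (spread xhat t + 2 * tau t)).
    rewrite /G /s /ncons natr_sum mulr_suml -big_split /= [RHS]exchange_big /=.
    apply: eq_bigr => j _; rewrite [RHS]exchange_big /=.
    rewrite (natr_mul_sum (m j)) -big_split /=.
    by apply: eq_bigr => k _; rewrite mulr_sumr big_split.
  rewrite sE ler_sum_nat // => t /andP[t1 _].
  apply: le_trans (enorm_posmx_mxcol _) _; apply: ler_sum => j _.
  by apply: ler_sum => k _; exact: constraint_transfer_le.
have GU : G <= ncons%:R * ((gamma T.+1)^-1 * dual_size T.+1
    + (\sum_(1 <= t < T.+1) beta t.+1 * dual_size t)
    + F2 * (\sum_(1 <= t < T.+1) total_move t)).
  pose U j := (gamma T.+1)^-1 * enorm (q j T.+1)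
    + \sum_(1 <= t < T.+1) beta t.+1 * enorm (q j t)
    + F2 * \sum_(1 <= t < T.+1) enorm (x j t.+1 - x j t).
  have U0 j : 0 <= U j.
    rewrite !addr_ge0 //.
    - by rewrite mulr_ge0 // invr_ge0 ltW // gamma_gt0.
    - by rewrite sumr_ge0 // => t _; rewrite mulr_ge0 // ltW // beta_gt0.
    - by rewrite mulr_ge0 ?(ltW F2_gt0) // sumr_ge0.
  have UE : \sum_j U j = (gamma T.+1)^-1 * dual_size T.+1
    + (\sum_(1 <= t < T.+1) beta t.+1 * dual_size t)
    + F2 * (\sum_(1 <= t < T.+1) total_move t).
    rewrite !big_split /= -!mulr_sumr; congr (_ + _ + _ * _).
      by rewrite exchange_big; apply: eq_bigr => t _; rewrite mulr_sumr.
    by rewrite exchange_big.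
  rewrite -UE mulr_sumr; apply: ler_sum => j _.
  apply: (@le_trans _ _ ((m j)%:R * U j)).
    rewrite (natr_mul_sum (m j)).
    by apply: ler_sum => k _; exact: sum_pos_constraint_le.
  rewrite ler_wpM2r // ler_nat /ncons (bigD1 j) //=; exact: leq_addr.
rewrite /net_ccv -(ler_pM2l nR) mulrA divff ?gt_eqF // mul1r.
apply: (@le_trans _ _ (n%:R * (G + ncons%:R * s))).
  rewrite (natr_mul_sum n).
  exact: ler_sum.
by rewrite ler_pM2l // mulrDr lerD2r.
Qed.

(** From |q| <= lam |q|^2 + 1 / (4 lam) and [energy_le] with a constant comparator, whose path
    length is zero; the loss differences are bounded below by - F1. The weight [lam] stays free, to
    be balanced later. *)
Lemma sum_dual_size_le T lam y : (0 < T)%N -> 0 < lam -> X y ->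
  (forall t, (1 <= t <= T)%N -> forall i, nonpos (g i t y)) ->
  (gamma T.+1)^-1 * dual_size T.+1 + \sum_(1 <= t < T.+1) beta t.+1 * dual_size t
  <= 2 * lam * (n%:R * (F1 + F2 * (2 * RX)) * T%:R
      + n%:R * (2 * cb ^+ 2) * (\sum_(1 <= t < T.+1) gamma t.+1)
      + n%:R * (2 * RX ^+ 2) * (alpha T.+1)^-1
      + n%:R * (2 * RX) * \sum_(1 <= t < T.+1) (alpha t.+1)^-1 * tau t)
    + n%:R / (4 * lam) * ((gamma T.+1)^-1 + \sum_(1 <= t < T.+1) beta t.+1).
Proof.
move=> T0 lam0 Xy gy.
have size_le t : dual_size t <= lam * dual_energy t + n%:R / (4 * lam).
  rewrite (natr_mul_sum n) mulr_sumr -big_split; apply: ler_sum => i _ /=.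
  have : 0 <= lam * (enorm (q i t) - (2 * lam)^-1) ^+ 2.
    by rewrite mulr_ge0 ?sqr_ge0 // ltW.
  have lam_neq0 : lam != 0 by rewrite gt_eqF.
  have -> : lam * (enorm (q i t) - (2 * lam)^-1) ^+ 2 =
    lam * enorm (q i t) ^+ 2 - enorm (q i t) + (4 * lam)^-1 by field.
  lra.
have en := energy_le T0 (fun t tT => conj Xy (gy t tT)).
have path0 : path_length T (fun=> y) = 0.
  by rewrite /path_length big1 // => t _; rewrite subrr enorm0.
rewrite path0 mulr0 addr0 in en.
have loss : - (n%:R * F1 * T%:R) <=
    \sum_(1 <= t < T.+1) \sum_i (f i t (x i t) - f i t y).
  rewrite -mulNr mulr_natr -[X in _ *+ X](subn0 T) -subSS -sumr_const_nat.
  rewrite ler_sum_nat // => t /andP[t1 _].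
  rewrite -mulrN (natr_mul_sum n) ler_sum // => i _.
  have := a1_f_bounded A1 i t1 (iterate_in i t1) Xy.
  by rewrite ler_norml => /andP[].
have move_le : \sum_(1 <= t < T.+1) total_move t <= n%:R * (2 * RX) * T%:R.
  rewrite mulr_natr -[X in _ *+ X](subn0 T) -subSS -sumr_const_nat.
  by rewrite ler_sum_nat // => t /andP[t1 _]; exact: total_move_le.
have {}move_le := ler_wpM2l (ltW F2_gt0) move_le.
have err0 : 0 <= \sum_(1 <= t < T.+1) (alpha t.+1)^-1 / 2 * err_energy t.
  rewrite sumr_ge0 // => t _; rewrite mulr_ge0 ?divr_ge0 //.
    by rewrite invr_ge0 ltW // alpha_gt0.
  by apply: sumr_ge0 => i _; exact: sqr_ge0.
have gV0 : 0 <= (gamma T.+1)^-1 by rewrite invr_ge0 ltW // gamma_gt0.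
have first_le := ler_wpM2l gV0 (size_le T.+1).
have sum_le : \sum_(1 <= t < T.+1) beta t.+1 * dual_size t <=
    lam * (\sum_(1 <= t < T.+1) beta t.+1 * dual_energy t)
    + n%:R / (4 * lam) * (\sum_(1 <= t < T.+1) beta t.+1).
  rewrite !mulr_sumr -big_split /= ler_sum_nat // => t _.
  have := ler_wpM2l (ltW (@beta_gt0 t.+1 isT)) (size_le t).
  by rewrite mulrDr (mulrCA _ lam) (mulrC (n%:R / _)).
have : (gamma T.+1)^-1 * dual_energy T.+1
    + \sum_(1 <= t < T.+1) beta t.+1 * dual_energy t <=
   2 * (n%:R * (F1 + F2 * (2 * RX)) * T%:R
      + n%:R * (2 * cb ^+ 2) * (\sum_(1 <= t < T.+1) gamma t.+1)
      + n%:R * (2 * RX ^+ 2) * (alpha T.+1)^-1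
      + n%:R * (2 * RX) * \sum_(1 <= t < T.+1) (alpha t.+1)^-1 * tau t).
  by move: en loss move_le err0; lra.
move=> /(ler_wpM2l (ltW lam0)).
move: (n%:R / (4 * lam)) first_le sum_le => c; lra.
Qed.

(** The same weighted inequality with a free [mu], applied to the squared step errors of
    [err_energy_le]. *)
Lemma sum_step_err_le T mu y : 0 < mu -> X y ->
  (forall t, (1 <= t <= T)%N -> forall i, nonpos (g i t y)) ->
  \sum_(1 <= t < T.+1) \sum_i enorm (step_err i t) <=
    mu * (2 * (n%:R * (F1 + 2 * cb ^+ 2 * gamma 1 + F2 * (2 * RX)))
      * (\sum_(1 <= t < T.+1) alpha t.+1)
    + n%:R * (4 * RX ^+ 2) + n%:R * (4 * RX) * \sum_(1 <= t < T.+1) tau t)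
    + n%:R / 4 * (T%:R / mu).
Proof.
move=> mu0 Xy gy.
apply: le_trans (lerD (ler_wpM2l (ltW mu0) (err_energy_le Xy gy)) (lexx _)).
have -> : n%:R / 4 * (T%:R / mu) = \sum_(1 <= t < T.+1) n%:R * (4 * mu)^-1.
  by rewrite sumr_const_nat subSS subn0 -[RHS]mulr_natr invfM; ring.
rewrite mulr_sumr -big_split /= ler_sum_nat // => t _.
rewrite (natr_mul_sum n) mulr_sumr -big_split; apply: ler_sum => i _ /=.
have : 0 <= mu * (enorm (step_err i t) - (2 * mu)^-1) ^+ 2.
  by rewrite mulr_ge0 ?sqr_ge0 // ltW.
have mu_neq0 : mu != 0 by rewrite gt_eqF.
have -> : mu * (enorm (step_err i t) - (2 * mu)^-1) ^+ 2 =
  mu * enorm (step_err i t) ^+ 2 - enorm (step_err i t) + (4 * mu)^-1 by field.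
lra.
Qed.

(** Since tau_t^2 <= tau_1 tau_t, the thresholds obey an estimate of the same form as the step
    errors, and both sums can be treated with one [mu]. *)
Lemma sum_tau_le T mu : 0 < mu ->
  \sum_(1 <= t < T.+1) tau t <=
    mu * (tau 1 * \sum_(1 <= t < T.+1) tau t) + 4^-1 * (T%:R / mu).
Proof.
move=> mu0; have -> : 4^-1 * (T%:R / mu) = \sum_(1 <= t < T.+1) (4 * mu)^-1.
  by rewrite sumr_const_nat subSS subn0 -[RHS]mulr_natr invfM; ring.
rewrite !mulr_sumr -big_split /= ler_sum_nat // => t /andP[t1 _].
have tau_le1 : tau t <= tau 1.
  by elim: t t1 => // -[|t] IH _ //; exact: le_trans (A3 _) (IH _).
have := ler_wpM2l (ltW mu0) (ler_wpM2r (tau_ge0 t1) tau_le1).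
have : 0 <= mu * (tau t - (2 * mu)^-1) ^+ 2.
  by rewrite mulr_ge0 ?sqr_ge0 // ltW.
have mu_neq0 : mu != 0 by rewrite gt_eqF.
have -> : mu * (tau t - (2 * mu)^-1) ^+ 2 =
  mu * (tau t * tau t) - tau t + (4 * mu)^-1 by field.
lra.
Qed.

(** A common upper bound for the coefficients that the radius, the step errors and the thresholds
    collect in [net_ccv_decomp]. *)
Definition err_gain : R := F2 * (n%:R + 2) * (1 + (n%:R + 1) * spread_gain).

Lemma net_ccv_le T : (0 < n)%N -> net_ccv g x T <=
  ncons%:R * ((gamma T.+1)^-1 * dual_size T.+1
    + (\sum_(1 <= t < T.+1) beta t.+1 * dual_size t)
    + err_gain * (RX + (\sum_(1 <= t < T.+1) \sum_i enorm (step_err i t))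
                  + \sum_(1 <= t < T.+1) tau t)).
Proof.
move=> n0; apply: le_trans (net_ccv_decomp T n0) _.
rewrite ler_wpM2l // -(addrA (_ * _ + _)) lerD2l -mulrDr /err_gain -!(mulrA F2).
rewrite ler_wpM2l ?(ltW F2_gt0) // big_split /= -mulr_sumr.
have spr := sum_spread_trigger_le T.
have mv := sum_total_move_le T.
have tau0 : 0 <= \sum_(1 <= t < T.+1) tau t.
  by rewrite big_nat sumr_ge0 // => t /andP[t1 _]; exact: tau_ge0.
have err0 : 0 <= \sum_(1 <= t < T.+1) \sum_i enorm (step_err i t).
  by rewrite sumr_ge0 // => t _; exact: sumr_ge0.
have nR : 0 <= n%:R :> R by [].
move: nR spr mv tau0 err0 spread_gain_ge0 RX_gt0; move: spread_gain RX (n%:R : R).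
move: (\sum_(_ <= _ < _) tau _) (\sum_(_ <= _ < _) spread _ _).
move: (\sum_(_ <= _ < _) total_move _) (\sum_(_ <= _ < _) \sum_i _).
move=> mv e ta sp ga r N N0 spr mvle ta0 e0 ga0 r0.
have s1 : (N + 1) * sp <= (N + 1) * (ga * (r + (e + N * ta))).
  by rewrite ler_wpM2l // addr_ge0.
have : 0 <= N * r + N * e by rewrite addr_ge0 // mulr_ge0 // ltW.
have : 0 <= (N + 1) ^+ 2 * (ga * (r + e)).
  by rewrite mulr_ge0 ?sqr_ge0 // mulr_ge0 // addr_ge0 // ltW.
have : 0 <= (N + 1) * (ga * ta) by rewrite mulr_ge0 ?mulr_ge0 ?addr_ge0.
move: mvle s1 r0 e0; lra.
Qed.

End Algorithm.

(** * Rates *)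

Ltac nonneg := repeat first
  [ done | exact: ltW | exact: sqr_ge0 | exact: powR_ge0
  | rewrite subr_ge0; exact: ltW
  | rewrite invr_ge0 | apply: addr_ge0 | apply: divr_ge0 | apply: mulr_ge0 ].

(** * Real powers of natural numbers *)

Section NatPowers.
Context {R : realType}.
Implicit Types (a : R) (t u T : nat).

Lemma natpow_gt0 a t : (1 <= t)%N -> 0 < t%:R `^ a.
Proof. by move=> t1; rewrite powR_gt0 // ltr0n. Qed.

Lemma natpow_mono a t u : 0 <= a -> (t <= u)%N -> (t%:R : R) `^ a <= u%:R `^ a.
Proof. by move=> a0 tu; rewrite ge0_ler_powR ?nnegrE // ler_nat. Qed.

Lemma natpow_ge1 a t : 0 <= a -> (1 <= t)%N -> 1 <= (t%:R : R) `^ a.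
Proof. by move=> a0 t1; rewrite -[leLHS](powRr0 t%:R) ler_powR // ler1n. Qed.

Lemma natpowD a b t : (1 <= t)%N ->
  (t%:R : R) `^ (a + b) = t%:R `^ a * t%:R `^ b.
Proof. by move=> t1; rewrite powRD // pnatr_eq0 -lt0n t1 implybT. Qed.

Lemma natpow_succ_le a t : 0 <= a <= 1 -> (1 <= t)%N ->
  (t.+1%:R : R) `^ a <= 2 * t%:R `^ a.
Proof.
move=> /andP[a0 a1] t1; apply: (@le_trans _ _ ((2 * t%:R) `^ a)).
  by rewrite -natrM natpow_mono // mul2n -addnn -addn1 leq_add2l.
rewrite powRM // ler_wpM2r ?powR_ge0 // -[leRHS](@powRr1 _ 2) // ler_powR //.
by rewrite ler1n.
Qed.

(** Written as t t^(-a), the power gains at most one copy of (t + 1)^(-a), because t^(-a) decreases.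
    This yields the growth condition on 1 / gamma. *)
Lemma natpow_incr_le a t : 0 <= a -> (1 <= t)%N ->
  (t.+1%:R : R) `^ (1 - a) - t%:R `^ (1 - a) <= t.+1%:R `^ (- a).
Proof.
move=> a0 t1; rewrite !natpowD // !powRr1 //.
have : (t.+1%:R : R) `^ (- a) <= t%:R `^ (- a).
  by rewrite !powRN lef_pV2 ?posrE ?natpow_gt0 // natpow_mono.
move=> /(ler_wpM2l (ler0n R t)); move: (_ `^ _) (_ `^ _) => u v.
by rewrite -natr1; lra.
Qed.

Lemma sum_shift_le (a : nat -> R) T :
  (forall t, (1 <= t)%N -> a t.+1 <= a t) ->
  \sum_(1 <= t < T.+1) a t.+1 <= \sum_(1 <= t < T.+1) a t.
Proof. by move=> am; rewrite ler_sum_nat // => t /andP[]; auto. Qed.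

Lemma sum_natpow_le a T : 0 <= a -> \sum_(1 <= t < T.+1) (t%:R : R) `^ (- a) <= T%:R.
Proof.
move=> a0; apply: (@le_trans _ _ (\sum_(1 <= t < T.+1) 1)).
  rewrite ler_sum_nat // => t /andP[t1 _].
  by rewrite powRN invf_le1 ?natpow_gt0 // natpow_ge1.
by rewrite sumr_const_nat subSS subn0.
Qed.

End NatPowers.

(** * Parameter sums and the resulting rates *)

Section Rates.
Context {R : realType} {n p : nat} {m : 'I_n -> nat}.
Variables (X : set 'cV[R]_p) (f : 'I_n -> nat -> 'cV[R]_p -> R).
Variable g : forall i : 'I_n, nat -> 'cV[R]_p -> 'cV[R]_(m i).
Variable df : 'I_n -> nat -> 'cV[R]_p -> 'cV[R]_p.
Variables dg dgpos : forall i : 'I_n, nat -> 'cV[R]_p -> 'M[R]_(p, m i).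
Variables (E : nat -> rel 'I_n) (W : nat -> 'M[R]_n).
Variables (RX F1 F2 w : R) (B : nat) (alpha beta gamma tau : nat -> R).
Variables (alpha0 tau0 theta1 theta2 theta3 : R).
Hypothesis n_gt0 : (0 < n)%N.
Hypothesis static_feasible :
  forall T, (1 <= T)%N -> static_feasible_seqs X g T !=set0.
Hypotheses (HW : mixing E W) (A1 : assumption1 X f g df dg dgpos RX F1 F2).
Hypotheses (A2 : assumption2 E W w B) (A3 : assumption3 tau).
Hypotheses (Htheta1 : 0 < theta1 < 1) (Htheta2 : 0 < theta2 < 1).
Hypotheses (Halpha0 : 0 < alpha0) (Htau0 : 0 < tau0) (Htheta3 : 0 < theta3).
Hypothesis Halpha : forall t, (1 <= t)%N -> alpha t = alpha0 / t%:R `^ theta1.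
Hypothesis Hbeta : forall t, (1 <= t)%N -> beta t = 1 / t%:R `^ theta2.
Hypothesis Hgamma : forall t, (1 <= t)%N -> gamma t = 1 / t%:R `^ (1 - theta2).
Hypothesis Htau : forall t, (1 <= t)%N -> tau t = tau0 / t%:R `^ theta3.

Let theta1_gt0 : 0 < theta1. Proof. by case/andP: Htheta1. Qed.
Let theta1_lt1 : theta1 < 1. Proof. by case/andP: Htheta1. Qed.
Let theta2_gt0 : 0 < theta2. Proof. by case/andP: Htheta2. Qed.
Let theta2_lt1 : theta2 < 1. Proof. by case/andP: Htheta2. Qed.

Let noninc (c a : R) : 0 <= c -> 0 <= a -> forall t, (1 <= t)%N ->
  c / t.+1%:R `^ a <= c / t%:R `^ a.
Proof.
move=> c0 a0 t t1; rewrite ler_wpM2l // lef_pV2 ?posrE ?natpow_gt0 //.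
exact: natpow_mono.
Qed.

Lemma alpha_rate_gt0 t : (1 <= t)%N -> 0 < alpha t.
Proof. by move=> t1; rewrite Halpha // divr_gt0 // natpow_gt0. Qed.

Lemma beta_rate_gt0 t : (1 <= t)%N -> 0 < beta t.
Proof. by move=> t1; rewrite Hbeta // divr_gt0 // natpow_gt0. Qed.

Lemma gamma_rate_gt0 t : (1 <= t)%N -> 0 < gamma t.
Proof. by move=> t1; rewrite Hgamma // divr_gt0 // natpow_gt0. Qed.

Lemma tau_rate_ge0 t : (1 <= t)%N -> 0 <= tau t.
Proof. by move=> t1; rewrite Htau // divr_ge0 ?powR_ge0 // ltW. Qed.

Lemma alpha_rate_noninc t : (1 <= t)%N -> alpha t.+1 <= alpha t.
Proof. by move=> t1; rewrite !Halpha // noninc // ltW. Qed.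

Lemma beta_rate_noninc t : (1 <= t)%N -> beta t.+1 <= beta t.
Proof. by move=> t1; rewrite !Hbeta // noninc // ltW. Qed.

Lemma gamma_rate_noninc t : (1 <= t)%N -> gamma t.+1 <= gamma t.
Proof. by move=> t1; rewrite !Hgamma // noninc // subr_ge0 ltW. Qed.

Lemma beta_gamma_rate_le1 t : (1 <= t)%N -> beta t.+1 * gamma t.+1 <= 1.
Proof.
move=> t1; rewrite Hbeta // Hgamma // !div1r -invfM -natpowD //.
by rewrite (addrC theta2) subrK powRr1 // invf_le1 ?ltr0n // ler1n.
Qed.

Lemma gammaV_rate_incr t : (1 <= t)%N ->
  (gamma t.+1)^-1 - (gamma t)^-1 <= beta t.+1.
Proof.
move=> t1; rewrite !Hgamma // Hbeta // !div1r !invrK -powRN.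
by rewrite natpow_incr_le // ltW.
Qed.

Lemma sum_alpha_le T :
  \sum_(1 <= t < T.+1) alpha t.+1
    <= (1 - theta1)^-1 * (alpha0 * T%:R `^ (1 - theta1)).
Proof.
apply: le_trans (sum_shift_le _ alpha_rate_noninc) _.
have -> : \sum_(1 <= t < T.+1) alpha t =
    alpha0 * \sum_(1 <= t < T.+1) t%:R `^ (1 - theta1 - 1).
  rewrite mulr_sumr; apply: eq_big_nat => t /andP[t1 _].
  by rewrite Halpha // -powRN addrAC subrr add0r.
rewrite mulrCA ler_wpM2l ?(ltW Halpha0) // sum_powR_lt1 //.
by rewrite subr_gt0 theta1_lt1 gerBl ltW.
Qed.

Lemma sum_gamma_le T :
  \sum_(1 <= t < T.+1) gamma t.+1 <= theta2^-1 * T%:R `^ theta2.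
Proof.
apply: le_trans (sum_shift_le _ gamma_rate_noninc) _.
have -> : \sum_(1 <= t < T.+1) gamma t = \sum_(1 <= t < T.+1) t%:R `^ (theta2 - 1).
  apply: eq_big_nat => t /andP[t1 _].
  by rewrite Hgamma // div1r -powRN opprB.
by rewrite sum_powR_lt1 // theta2_gt0 ltW.
Qed.

Lemma sum_beta_le T :
  \sum_(1 <= t < T.+1) beta t.+1 <= (1 - theta2)^-1 * T%:R `^ (1 - theta2).
Proof.
apply: le_trans (sum_shift_le _ beta_rate_noninc) _.
have -> : \sum_(1 <= t < T.+1) beta t =
    \sum_(1 <= t < T.+1) t%:R `^ (1 - theta2 - 1).
  apply: eq_big_nat => t /andP[t1 _].
  by rewrite Hbeta // div1r -powRN addrAC subrr add0r.
by rewrite sum_powR_lt1 // subr_gt0 theta2_lt1 gerBl ltW.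
Qed.

Lemma alphaV_le t : (1 <= t)%N ->
  (alpha t.+1)^-1 <= 2 * (t%:R `^ theta1 / alpha0).
Proof.
move=> t1; rewrite Halpha // invf_div mulrA ler_pM2r ?invr_gt0 //.
by rewrite natpow_succ_le // !ltW.
Qed.

Lemma gammaV_le t : (1 <= t)%N -> (gamma t.+1)^-1 <= 2 * t%:R `^ (1 - theta2).
Proof.
move=> t1; rewrite Hgamma // div1r invrK natpow_succ_le //.
by rewrite subr_ge0 gerBl !ltW.
Qed.

Lemma sum_tauE T :
  \sum_(1 <= t < T.+1) tau t = tau0 * \sum_(1 <= t < T.+1) t%:R `^ (- theta3).
Proof.
by rewrite mulr_sumr; apply: eq_big_nat => t /andP[t1 _]; rewrite Htau // powRN.
Qed.

Lemma sum_tau_alpha_le T : \sum_(1 <= t < T.+1) (alpha t.+1)^-1 * tau t <=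
  2 * (tau0 / alpha0) * \sum_(1 <= t < T.+1) t%:R `^ (- (theta3 - theta1)).
Proof.
rewrite mulr_sumr ler_sum_nat // => t /andP[t1 _].
rewrite Htau // opprB natpowD // powRN.
have := ler_wpM2r (_ : 0 <= tau0 / t%:R `^ theta3) (alphaV_le t1).
have t0 : 0 <= tau0 / t%:R `^ theta3 by rewrite divr_ge0 ?powR_ge0 // ltW.
move=> /(_ t0) /le_trans; apply.
by rewrite le_eqVlt; apply/orP; left; apply/eqP; ring.
Qed.

(** As alpha never exceeds alpha0, the plain threshold sum is dominated by the one weighted with 1 /
    alpha, and needs no term of its own in the rate. *)
Lemma sum_tau_le_tau_alpha T : \sum_(1 <= t < T.+1) tau t <=
  alpha0 * \sum_(1 <= t < T.+1) (alpha t.+1)^-1 * tau t.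
Proof.
rewrite mulr_sumr ler_sum_nat // => t /andP[t1 _].
rewrite mulrA -[leLHS]mul1r ler_wpM2r ?tau_rate_ge0 //.
rewrite Halpha // invf_div mulrCA divff ?gt_eqF // mulr1.
by rewrite natpow_ge1 // ltW.
Qed.

(** [Z] stands for the growth of the threshold sum, so that one argument serves the power,
    logarithmic and bounded regimes. *)
Lemma net_reg_rate (Z : nat -> R) (k : R) : 0 <= k ->
  (forall T, (1 <= T)%N -> 0 <= Z T) ->
  (forall T, (1 <= T)%N ->
    \sum_(1 <= t < T.+1) (t%:R : R) `^ (- (theta3 - theta1)) <= k * (1 + Z T)) ->
  exists2 C : R, 0 < C &
    forall (x xhat z omega : 'I_n -> nat -> 'cV[R]_p)
           (q : forall i : 'I_n, nat -> 'cV[R]_(m i)),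
    algorithm1 X g df dgpos W alpha beta gamma tau x xhat z omega q ->
    forall T : nat, (1 <= T)%N ->
    forall y : nat -> 'cV[R]_p, feasible_seqs X g T y ->
    net_reg f x T y <=
      C * (alpha0 * T%:R `^ (1 - theta1) + T%:R `^ theta2
           + tau0 / alpha0 * Z T
           + T%:R `^ theta1 * (1 + path_length T y) / alpha0).
Proof.
move=> k0 Z0 Zk.
have nR : 0 < n%:R :> R by rewrite ltr0n.
have RX0 := a1_RX_gt0 A1; have F20 := a1_F2_gt0 A1.
set cb := @model_bound R n m RX F1 F2.
set ew := @err_weight R n F2 w B.
set sg := @spread_gain R n w B.
have sg0 : 0 <= sg := spread_gain_ge0 A2.
pose c1 := n%:R * (2 * cb ^+ 2) / theta2.
pose c2 := n%:R * (ew ^+ 2 / 2) / (1 - theta1).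
pose c3 := n%:R * (4 * RX ^+ 2) + n%:R * (4 * RX).
pose c4 := n%:R * (2 * RX) + n%:R * (F2 * 2 + ew) * alpha0.
pose c5 := 2 * n%:R * F2 * sg * RX.
pose r := tau0 / alpha0.
have r0 : 0 < r by rewrite divr_gt0.
have ew0 : 0 <= ew.
  apply: mulr_ge0; first exact: ltW.
  by apply: addr_ge0 => //; apply: mulr_ge0 => //; exact: mulr_ge0.
have c10 : 0 <= c1 by rewrite /c1; nonneg.
have c20 : 0 <= c2 by rewrite /c2; nonneg.
have c30 : 0 <= c3 by rewrite /c3; nonneg.
have c40 : 0 <= c4 by rewrite /c4; nonneg.
have c50 : 0 <= c5 by rewrite /c5; nonneg.
(* Fixed before the run, T and the comparator are introduced; the leading 1 makes it positive. *)
exists (n%:R^-1 * (1 + c1 + c2 + c3 + c4 * (2 * k) * (1 + r) + c5)).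
  by rewrite mulr_gt0 ?invr_gt0 // -!addrA ltr_wpDr //; nonneg.
move=> x xhat z omega q alg T T1 y Hy.
have := net_reg_le HW A1 A2 A3 alpha_rate_gt0 alpha_rate_noninc beta_rate_gt0
  beta_rate_noninc gamma_rate_gt0 beta_gamma_rate_le1 gammaV_rate_incr
  tau_rate_ge0 alg n_gt0 T1 Hy.
rewrite -/cb -/ew -/sg -ler_pdivlMl // => /le_trans; apply.
rewrite -[leRHS]mulrA ler_pM2l ?invr_gt0 //.
set P := path_length T y.
have P0 : 0 <= P by apply: sumr_ge0.
set G1 := alpha0 * _; set G2 := T%:R `^ theta2; set G3 := _ * Z T.
set G4 := _ / alpha0; set G := G1 + G2 + G3 + G4.
have G10 : 0 <= G1 by rewrite mulr_ge0 ?powR_ge0 // ltW.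
have G21 : 1 <= G2 by rewrite natpow_ge1 // ltW.
have G30 : 0 <= G3 by rewrite mulr_ge0 ?Z0 // ltW.
have G40 : 0 <= G4.
  by rewrite /G4; nonneg.
have b1 : n%:R * (2 * cb ^+ 2) * (\sum_(1 <= t < T.+1) gamma t.+1) <= c1 * G.
  apply: (@le_trans _ _ (c1 * G2)); last by rewrite ler_wpM2l // /G; lra.
  rewrite /c1 -[leRHS]mulrA ler_wpM2l //; [by nonneg | exact: sum_gamma_le].
have b2 : n%:R * (ew ^+ 2 / 2) * (\sum_(1 <= t < T.+1) alpha t.+1) <= c2 * G.
  apply: (@le_trans _ _ (c2 * G1)); last by rewrite ler_wpM2l // /G; lra.
  rewrite /c2 -[leRHS]mulrA ler_wpM2l //; [by nonneg | exact: sum_alpha_le].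
have b3 : (alpha T.+1)^-1 / 2 *
    (n%:R * (4 * RX ^+ 2) + n%:R * (4 * RX) * P) <= c3 * G.
  apply: (@le_trans _ _ (c3 * G4)); last by rewrite ler_wpM2l // /G; lra.
  apply: (@le_trans _ _ (T%:R `^ theta1 / alpha0 * (c3 * (1 + P)))).
    apply: ler_pM.
    - by rewrite divr_ge0 // invr_ge0 ltW // alpha_rate_gt0.
    - by nonneg.
    - have := alphaV_le T1; lra.
    - have : 0 <= n%:R * (4 * RX ^+ 2) * P by nonneg.
      have : 0 <= n%:R * (4 * RX) by nonneg.
      by rewrite /c3; lra.
  by rewrite le_eqVlt; apply/orP; left; apply/eqP; rewrite /G4; ring.
set S := \sum_(1 <= t < T.+1) (alpha t.+1)^-1 * tau t.
(* The constant part of k (1 + Z T) is absorbed by T^theta2 >= 1, the rest by the threshold term. *)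
have bS : S <= 2 * k * (1 + r) * G.
  apply: le_trans (sum_tau_alpha_le T) _; rewrite -/r.
  apply: (@le_trans _ _ (2 * r * (k * (1 + Z T)))).
    by rewrite ler_wpM2l ?Zk // mulr_ge0 // ltW.
  have h1 : 0 <= k * (1 + r) * (G1 + G4).
    by nonneg.
  have h2 : 0 <= k * (1 + r) * (G2 - 1).
    by rewrite mulr_ge0 ?subr_ge0 //; nonneg.
  have h3 : 0 <= k * r * G3 by nonneg.
  move: h1 h2 h3 k0; rewrite /G /G3 -/r; lra.
have b4 : n%:R * (2 * RX) * S + n%:R * (F2 * 2 + ew) * \sum_(1 <= t < T.+1) tau t
    <= c4 * (2 * k) * (1 + r) * G.
  apply: (@le_trans _ _ (c4 * S)).
    rewrite /c4 [leRHS]mulrDl lerD2l -[leRHS]mulrA ler_wpM2l //.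
      by nonneg.
    exact: sum_tau_le_tau_alpha.
  by rewrite -!mulrA ler_wpM2l // !mulrA.
have b5 : c5 <= c5 * G by rewrite ler_peMr // /G; lra.
have G0 : 0 <= G by rewrite /G; lra.
move: b1 b2 b3 b4 b5 G0; rewrite /c5; lra.
Qed.

(** [third] is the square root of tau0 T Z. The dual terms give the theta2 rate; step errors and
    thresholds give the two others, each a root of T times a sum. *)
Lemma net_ccv_rate (Z third : nat -> R) (k : R) : theta1 <= theta3 -> 0 <= k ->
  (forall T, (1 <= T)%N -> 0 <= third T) ->
  (forall T, (1 <= T)%N -> third T ^+ 2 = tau0 * T%:R * Z T) ->
  (forall T, (1 <= T)%N ->
    \sum_(1 <= t < T.+1) (t%:R : R) `^ (- theta3) <= k * (1 + Z T)) ->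
  exists2 C : R, 0 < C &
    forall (x xhat z omega : 'I_n -> nat -> 'cV[R]_p)
           (q : forall i : 'I_n, nat -> 'cV[R]_(m i)),
    algorithm1 X g df dgpos W alpha beta gamma tau x xhat z omega q ->
    forall T : nat, (1 <= T)%N ->
    net_ccv g x T <=
      C * (Num.sqrt alpha0 * T%:R `^ (1 - theta1 / 2)
           + T%:R `^ (1 - theta2 / 2) + third T).
Proof.
move=> theta13 k0 third0 thirdE Zk.
have nR : 0 < n%:R :> R by rewrite ltr0n.
have RX0 := a1_RX_gt0 A1; have F10 := a1_F1_gt0 A1; have F20 := a1_F2_gt0 A1.
have g1 := @gamma_rate_gt0 1 isT; have ta1 := @tau_rate_ge0 1 isT.
set cb := @model_bound R n m RX F1 F2.
set eg := @err_gain R n F2 w B.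
set M : R := (@ncons n m)%:R.
have eg0 : 0 <= eg.
  apply: mulr_ge0; first by rewrite mulr_ge0 ?addr_ge0 // ltW.
  by rewrite addr_ge0 // mulr_ge0 ?addr_ge0 // (spread_gain_ge0 A2).
pose k1 := n%:R * (F1 + F2 * (2 * RX)); pose k2 := n%:R * (2 * cb ^+ 2).
pose k3 := n%:R * (2 * RX ^+ 2); pose k4 := n%:R * (2 * RX).
pose k5 := 2 * (n%:R * (F1 + 2 * cb ^+ 2 * gamma 1 + F2 * (2 * RX))).
pose k6 := n%:R * (4 * RX ^+ 2); pose k7 := n%:R * (4 * RX).
have k10 : 0 <= k1 by rewrite /k1; nonneg.
have k20 : 0 <= k2 by rewrite /k2; nonneg.
have k30 : 0 <= k3 by rewrite /k3; nonneg.
have k40 : 0 <= k4 by rewrite /k4; nonneg.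
have k50 : 0 <= k5 by rewrite /k5; nonneg.
have k60 : 0 <= k6 by rewrite /k6; nonneg.
have k70 : 0 <= k7 by rewrite /k7; nonneg.
pose K1 := k1 + k2 / theta2 + k3 * (2 / alpha0) + k4 * (2 * (tau0 / alpha0)).
pose K2 := n%:R / 4 * (2 + (1 - theta2)^-1).
pose a1 := (1 - theta1)^-1; pose a2 := alpha0^-1; pose a3 := k * (tau0 * a2 + 1).
pose KE := k5 * a1 + k6 * a2 + k7 * a3 + n%:R / 4.
pose KT := tau 1 * a3 + 4^-1.
have a10 : 0 <= a1 by rewrite /a1; nonneg.
have a20 : 0 <= a2 by rewrite /a2; nonneg.
have a30 : 0 <= a3 by rewrite /a3; nonneg.
have K10 : 0 <= K1 by rewrite /K1; nonneg.
have K20 : 0 <= K2 by rewrite /K2; nonneg.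
have KE0 : 0 <= KE by rewrite /KE; nonneg.
have KT0 : 0 <= KT by rewrite /KT; nonneg.
exists (1 + M * (2 * K1 + K2 + eg * (RX + KE + KT))).
  by rewrite ltr_wpDr //; nonneg.
move=> x xhat z omega q alg T T1.
(* This static point may depend on T; the constant chosen above does not involve it. *)
have [y' [y Xy Hy]] := static_feasible T1.
have {}Hy t : (1 <= t <= T)%N -> forall i, nonpos (g i t y).
  by move=> tT; have [_] := Hy t tT; exact: nonpos_mxcol.
have TR : 0 < T%:R :> R by rewrite ltr0n.
have T1R : 1 <= T%:R :> R by rewrite ler1n.
set A := Num.sqrt alpha0 * _; set U := T%:R `^ (1 - theta2 / 2).
(* H^2 dominates, up to constants, T times each of the alpha sum, 1 and the tau sum. [A] keeps H
   positive where [third T] vanishes, as with ln T at T = 1. *)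
pose H := A + third T.
have A0 : 0 < A by rewrite mulr_gt0 ?sqrtr_gt0 // natpow_gt0.
have H0 : 0 < H by rewrite ltr_wpDr // third0.
have U1 : 1 <= U by rewrite natpow_ge1 // subr_ge0; have := theta2_lt1; lra.
have A2E : A ^+ 2 = alpha0 * (T%:R * T%:R `^ (1 - theta1)).
  rewrite exprMn sqr_sqrtr ?(ltW Halpha0) //; congr (_ * _).
  rewrite -{2}(powRr1 (ltW TR)) expr2 -!natpowD //; congr (_ `^ _); lra.
have AH : A ^+ 2 <= H ^+ 2.
  by rewrite ler_sqr ?nnegrE ?(ltW A0) ?(ltW H0) // /H lerDl third0.
have thirdH : third T ^+ 2 <= H ^+ 2.
  by rewrite ler_sqr ?nnegrE ?third0 ?(ltW H0) // /H lerDr ltW.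
set SA := \sum_(1 <= t < T.+1) alpha t.+1.
set ST := \sum_(1 <= t < T.+1) tau t.
have hA : T%:R * SA <= a1 * H ^+ 2.
  apply: le_trans (ler_wpM2l a10 AH).
  have := ler_wpM2l (ltW TR) (sum_alpha_le T); rewrite -/SA -/a1 A2E.
  by move: (T%:R `^ _) => u; lra.
have h1 : T%:R * 1 <= a2 * H ^+ 2.
  apply: le_trans (ler_wpM2l a20 AH).
  rewrite A2E /a2 mulKf ?gt_eqF // ler_pM2l //.
  by rewrite natpow_ge1 // subr_ge0 ltW.
have hT : T%:R * ST <= a3 * H ^+ 2.
  apply: (@le_trans _ _ (k * (tau0 * T%:R + third T ^+ 2))).
    rewrite thirdE // /ST sum_tauE.
    have := ler_wpM2l (ltW (mulr_gt0 TR Htau0)) (Zk T T1); lra.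
  rewrite /a3 -mulrA ler_wpM2l // mulrDl mul1r lerD //.
  by rewrite -mulrA ler_wpM2l ?(ltW Htau0) //; move: h1; rewrite mulr1.
(* Young's inequality turns the bound on squared step errors into one of order H. *)
pose mu := T%:R / H.
have mu0 : 0 < mu by rewrite divr_gt0.
have muV : T%:R / mu = H by rewrite /mu invf_div mulrCA divff ?gt_eqF // mulr1.
have muM c Y : T%:R * Y <= c * H ^+ 2 -> mu * Y <= c * H.
  by rewrite /mu mulrAC ler_pdivrMr // -mulrA -expr2.
have errT := sum_step_err_le A1 A2 alpha_rate_gt0 alpha_rate_noninc beta_rate_gt0
  beta_rate_noninc gamma_rate_gt0 gamma_rate_noninc beta_gamma_rate_le1
  gammaV_rate_incr tau_rate_ge0 alg mu0 Xy Hy.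
rewrite -/cb -/SA -/ST -/k5 -/k6 -/k7 muV in errT.
have tauT := sum_tau_le A3 tau_rate_ge0 T mu0.
rewrite -/ST muV in tauT.
set EN := \sum_(1 <= t < T.+1) \sum_i _ in errT.
have ENle : EN <= KE * H.
  apply: (le_trans errT).
  have := ler_wpM2l k50 (muM _ _ hA); have := ler_wpM2l k70 (muM _ _ hT).
  have := ler_wpM2l k60 (muM _ _ h1); rewrite /KE; lra.
have STle : ST <= KT * H.
  apply: (le_trans tauT).
  have := ler_wpM2l ta1 (muM _ _ hT); rewrite /KT; lra.
(* This weight balances [lam * T] against [T `^ (1 - theta2) / lam]. *)
pose lam : R := T%:R `^ (- (theta2 / 2)).
have lam0 : 0 < lam by rewrite natpow_gt0.
have lamT : lam * T%:R = U.
  by rewrite /lam -{2}(powRr1 (ltW TR)) -natpowD // addrC.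
have lamV : lam^-1 * T%:R `^ (1 - theta2) = U.
  rewrite /lam powRN invrK -natpowD //; congr (_ `^ _); lra.
have powT a : a <= 1 -> (T%:R : R) `^ a <= T%:R by move=> a1'; exact: ler1_powR.
have dual := sum_dual_size_le A1 A2 alpha_rate_gt0 alpha_rate_noninc
  beta_rate_gt0 beta_rate_noninc gamma_rate_gt0 beta_gamma_rate_le1
  gammaV_rate_incr tau_rate_ge0 alg T1 lam0 Xy Hy.
rewrite -/cb -/k1 -/k2 -/k3 -/k4 in dual.
have dualU : (gamma T.+1)^-1 * dual_size q T.+1
    + \sum_(1 <= t < T.+1) beta t.+1 * dual_size q t <= (2 * K1 + K2) * U.
  apply: (le_trans dual); rewrite [leRHS]mulrDl lerD //.
    rewrite (_ : 2 * K1 * U = 2 * lam * (K1 * T%:R)); last by rewrite -lamT; ring.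
    rewrite ler_wpM2l ?mulr_ge0 ?(ltW lam0) //.
    (* Every term of the bracket is at most a multiple of T; for the threshold sum this is where
       theta1 <= theta3 enters. *)
    have e1 : \sum_(1 <= t < T.+1) gamma t.+1 <= theta2^-1 * T%:R.
      apply: le_trans (sum_gamma_le T) _.
      by rewrite ler_wpM2l ?invr_ge0 ?powT // ltW.
    have e2 : (alpha T.+1)^-1 <= 2 / alpha0 * T%:R.
      apply: le_trans (alphaV_le T1) _; rewrite mulrCA mulrC.
      by rewrite ler_wpM2l ?divr_ge0 ?powT // ltW.
    have e3 : \sum_(1 <= t < T.+1) (alpha t.+1)^-1 * tau t <=
        2 * (tau0 / alpha0) * T%:R.
      apply: le_trans (sum_tau_alpha_le T) _.
      by rewrite ler_wpM2l ?sum_natpow_le ?subr_ge0 // !mulr_ge0 ?invr_ge0 // ltW.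
    have := ler_wpM2l k20 e1; have := ler_wpM2l k30 e2; have := ler_wpM2l k40 e3.
    rewrite /K1; move: (\sum_(_ <= _ < _) gamma _) (\sum_(_ <= _ < _) _ * tau _).
    by move: (alpha _)^-1 theta2^-1 alpha0^-1 => *; lra.
  apply: (@le_trans _ _ (n%:R / (4 * lam) *
      ((2 + (1 - theta2)^-1) * T%:R `^ (1 - theta2)))).
    rewrite ler_wpM2l ?divr_ge0 ?mulr_ge0 ?(ltW lam0) // mulrDl lerD //.
      exact: gammaV_le.
    exact: sum_beta_le.
  by rewrite /K2 -lamV invfM; lra.
have := net_ccv_le HW A1 A2 A3 beta_rate_gt0 gamma_rate_gt0 gamma_rate_noninc
  tau_rate_ge0 alg T n_gt0.
rewrite -/M -/eg -/EN -/ST => /le_trans; apply.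
have UH0 : 0 <= A + U + third T by rewrite !addr_ge0 ?third0 ?(ltW A0) //; lra.
have UH : U <= A + U + third T by have := third0 T T1; lra.
have HU : H <= A + U + third T by rewrite /H; lra.
rewrite mulrDl mul1r ler_wpDl // -mulrA ler_wpM2l // mulrDl lerD //.
  by apply: (le_trans dualU); rewrite ler_wpM2l //; nonneg.
rewrite -mulrA ler_wpM2l // 2!mulrDl !lerD //.
- by rewrite ler_peMr ?(ltW RX0) //; lra.
- by apply: (le_trans ENle); rewrite ler_wpM2l.
- by apply: (le_trans STle); rewrite ler_wpM2l.
Qed.

End Rates.

Theorem theorem2 (R : realType) (n p : nat) (m : 'I_n -> nat)
  (X : set 'cV[R]_p)
  (f : 'I_n -> nat -> 'cV[R]_p -> R)
  (g : forall i : 'I_n, nat -> 'cV[R]_p -> 'cV[R]_(m i))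
  (df : 'I_n -> nat -> 'cV[R]_p -> 'cV[R]_p)
  (dg dgpos : forall i : 'I_n, nat -> 'cV[R]_p -> 'M[R]_(p, m i))
  (E : nat -> rel 'I_n) (W : nat -> 'M[R]_n)
  (RX F1 F2 w : R) (B : nat)
  (alpha beta gamma tau : nat -> R)
  (alpha0 tau0 theta1 theta2 theta3 : R)
  (n_gt0 : (0 < n)%N)
  (feasible : forall T, (1 <= T)%N -> feasible_seqs X g T !=set0)
  (static_feasible : forall T, (1 <= T)%N -> static_feasible_seqs X g T !=set0)
  (HW : mixing E W)
  (A1 : assumption1 X f g df dg dgpos RX F1 F2)
  (A2 : assumption2 E W w B)
  (A3 : assumption3 tau)
  (Htheta1 : 0 < theta1 < 1) (Htheta2 : 0 < theta2 < 1)
  (Halpha0 : 0 < alpha0) (Htau0 : 0 < tau0) (Htheta3 : 0 < theta3)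
  (Halpha : forall t, (1 <= t)%N -> alpha t = alpha0 / t%:R `^ theta1)
  (Hbeta : forall t, (1 <= t)%N -> beta t = 1 / t%:R `^ theta2)
  (Hgamma : forall t, (1 <= t)%N -> gamma t = 1 / t%:R `^ (1 - theta2))
  (Htau : forall t, (1 <= t)%N -> tau t = tau0 / t%:R `^ theta3) :
  (exists2 C : R, 0 < C & exists T0 : nat,
    forall (x xhat z omega : 'I_n -> nat -> 'cV[R]_p)
           (q : forall i : 'I_n, nat -> 'cV[R]_(m i)),
    algorithm1 X g df dgpos W alpha beta gamma tau x xhat z omega q ->
    forall T : nat, (1 <= T)%N -> (T0 <= T)%N ->
    forall y : nat -> 'cV[R]_p, feasible_seqs X g T y ->
    [/\ theta1 < theta3 < 1 + theta1 ->
          net_reg f x T y <=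
          C * (alpha0 * T%:R `^ (1 - theta1) + T%:R `^ theta2
               + tau0 / alpha0 * T%:R `^ (1 + theta1 - theta3)
               + T%:R `^ theta1 * (1 + path_length T y) / alpha0),
        theta3 = 1 + theta1 ->
          net_reg f x T y <=
          C * (alpha0 * T%:R `^ (1 - theta1) + T%:R `^ theta2
               + tau0 / alpha0 * ln T%:R
               + T%:R `^ theta1 * (1 + path_length T y) / alpha0)
      & 1 + theta1 < theta3 ->
          net_reg f x T y <=
          C * (alpha0 * T%:R `^ (1 - theta1) + T%:R `^ theta2
               + tau0 / alpha0
               + T%:R `^ theta1 * (1 + path_length T y) / alpha0)])
  /\
  (exists2 C : R, 0 < C & exists T0 : nat,
    forall (x xhat z omega : 'I_n -> nat -> 'cV[R]_p)
           (q : forall i : 'I_n, nat -> 'cV[R]_(m i)),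
    algorithm1 X g df dgpos W alpha beta gamma tau x xhat z omega q ->
    forall T : nat, (1 <= T)%N -> (T0 <= T)%N ->
    [/\ theta1 < theta3 < 1 ->
          net_ccv g x T <=
          C * (Num.sqrt alpha0 * T%:R `^ (1 - theta1 / 2)
               + T%:R `^ (1 - theta2 / 2)
               + Num.sqrt tau0 * T%:R `^ (1 - theta3 / 2)),
        theta3 = 1 ->
          net_ccv g x T <=
          C * (Num.sqrt alpha0 * T%:R `^ (1 - theta1 / 2)
               + T%:R `^ (1 - theta2 / 2)
               + Num.sqrt (tau0 * T%:R * ln T%:R))
      & 1 < theta3 ->
          net_ccv g x T <=
          C * (Num.sqrt alpha0 * T%:R `^ (1 - theta1 / 2)
               + T%:R `^ (1 - theta2 / 2)
               + Num.sqrt tau0 * T%:R `^ (1 / 2))]).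
Proof.
(* The three regimes of a power sum, each in the shape k (1 + Z T) of the rate lemmas; the added 1
   covers ln 1 = 0. *)
have th13 (a : R) : 0 < a < 1 -> (forall T, (1 <= T)%N ->
    \sum_(1 <= t < T.+1) (t%:R : R) `^ (- a)
      <= (1 - a)^-1 * (1 + T%:R `^ (1 - a))).
  move=> /andP[a0 a1] T T1; have := @sum_powR_lt1 R (1 - a) T.
  rewrite subr_gt0 a1 gerBl (ltW a0) addrAC subrr add0r => /(_ isT) /le_trans.
  by apply; rewrite ler_wpM2l ?invr_ge0 ?subr_ge0 ?(ltW a1) // lerDr.
have inv_sum T : (1 <= T)%N ->
    \sum_(1 <= t < T.+1) (t%:R : R) `^ (- 1) <= 1 * (1 + ln T%:R).
  move=> T1; rewrite mul1r; apply: le_trans (sum_inv_le T1).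
  by rewrite ler_sum_nat // => t _; rewrite powR_inv1.
have conv_sum (a : R) T : 1 < a ->
    \sum_(1 <= t < T.+1) (t%:R : R) `^ (- a) <= (1 + (a - 1)^-1) * (1 + 1).
  move=> a1; have := @sum_powR_gt1 R (a - 1) T; rewrite subr_gt0 => /(_ a1).
  rewrite addrC subrK => /le_trans; apply.
  have : 0 <= (a - 1)^-1 by rewrite invr_ge0 subr_ge0 ltW.
  by move: (_^-1) => c; lra.
have ln_nat_ge0 T : (1 <= T)%N -> 0 <= ln (T%:R : R).
  by move=> T1; rewrite ln_ge0 // ler1n.
have reg := net_reg_rate n_gt0 HW A1 A2 A3 Htheta1 Htheta2 Halpha0 Htau0 Halpha
  Hbeta Hgamma Htau.
have ccv := net_ccv_rate n_gt0 static_feasible HW A1 A2 A3 Htheta1 Htheta2 Halpha0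
  Htau0 Halpha Hbeta Hgamma Htau.
have /andP[th1_0 th1_1] := Htheta1.
split.
- have [d1|d1|d1] := ltgtP theta3 (1 + theta1).
  (* For theta3 <= theta1 the premises of all three cases fail, so any constant serves. *)
  + have [th|th] := leP theta3 theta1.
      exists 1 => //; exists 0%N => x xhat z omega q alg T T1 _ y Hy.
      by split=> [/andP[]||]; lra.
    have d01 : 0 < theta3 - theta1 < 1 by lra.
    have k0 : 0 <= (1 - (theta3 - theta1))^-1 by rewrite invr_ge0; lra.
    have [C C0 HC] := reg (fun T => T%:R `^ (1 - (theta3 - theta1))) _ k0
      (fun _ _ => powR_ge0 _ _) (th13 _ d01).
    (* The rate holds for every T >= 1, so 0 serves as the threshold on T. *)
    exists C => //; exists 0%N => x xhat z omega q alg T T1 _ y Hy.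
    split=> [_||]; [|lra|lra].
    have := HC _ _ _ _ _ alg T T1 y Hy.
    by rewrite (_ : 1 + theta1 - theta3 = 1 - (theta3 - theta1)) //; ring.
  + have d01 : 1 < theta3 - theta1 by lra.
    have k0 : 0 <= 1 + (theta3 - theta1 - 1)^-1.
      by rewrite addr_ge0 // invr_ge0; lra.
    have [C C0 HC] := reg (fun=> 1) _ k0 (fun _ _ => ler01)
      (fun T _ => conv_sum _ T d01).
    exists C => //; exists 0%N => x xhat z omega q alg T T1 _ y Hy.
    split=> [/andP[]||_]; [lra|lra|].
    by have := HC _ _ _ _ _ alg T T1 y Hy; rewrite mulr1.
  + have dE : theta3 - theta1 = 1 by lra.
    rewrite dE in reg.
    have [C C0 HC] := reg (fun T => ln T%:R) _ ler01 ln_nat_ge0 inv_sum.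
    exists C => //; exists 0%N => x xhat z omega q alg T T1 _ y Hy.
    split=> [/andP[]|_|]; [lra| |lra].
    exact: HC _ _ _ _ _ alg T T1 y Hy.
- have [d1|d1|d1] := ltgtP theta3 1.
  + have [th|th] := leP theta3 theta1.
      exists 1 => //; exists 0%N => x xhat z omega q alg T T1 _.
      by split=> [/andP[]||]; lra.
    have k0 : 0 <= (1 - theta3)^-1 by rewrite invr_ge0; lra.
    have d01 : 0 < theta3 < 1 by rewrite Htheta3.
    have [||C C0 HC] := ccv (fun T => T%:R `^ (1 - theta3))
      (fun T => Num.sqrt tau0 * T%:R `^ (1 - theta3 / 2)) _ (ltW th) k0 _ _
      (th13 _ d01).
    * by move=> T _; rewrite mulr_ge0 ?sqrtr_ge0 ?powR_ge0.
    * move=> T T1; rewrite exprMn sqr_sqrtr ?(ltW Htau0) // -mulrA; congr (_ * _).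
      rewrite -{2}(powRr1 (ler0n R T)) expr2 -!natpowD //; congr (_ `^ _); lra.
    exists C => //; exists 0%N => x xhat z omega q alg T T1 _.
    split=> [_||]; [|lra|lra].
    exact: HC _ _ _ _ _ alg T T1.
  + have k0 : 0 <= 1 + (theta3 - 1)^-1 by rewrite addr_ge0 // invr_ge0; lra.
    have th : theta1 <= theta3 by lra.
    have [||C C0 HC] := ccv (fun=> 1)
      (fun T => Num.sqrt tau0 * T%:R `^ (1 / 2)) _ th k0 _ _
      (fun T _ => conv_sum _ T d1).
    * by move=> T _; rewrite mulr_ge0 ?sqrtr_ge0 ?powR_ge0.
    * move=> T T1; rewrite exprMn sqr_sqrtr ?(ltW Htau0) // mulr1; congr (_ * _).
      rewrite -{2}(powRr1 (ler0n R T)) expr2 -!natpowD //; congr (_ `^ _); lra.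
    exists C => //; exists 0%N => x xhat z omega q alg T T1 _.
    split=> [/andP[]||_]; [lra|lra|].
    exact: HC _ _ _ _ _ alg T T1.
  + have th : theta1 <= theta3 by lra.
    rewrite d1 in ccv th.
    have [||C C0 HC] := ccv (fun T => ln T%:R)
      (fun T => Num.sqrt (tau0 * T%:R * ln T%:R)) _ th ler01 _ _ inv_sum.
    * by move=> T _; rewrite sqrtr_ge0.
    * by move=> T T1; rewrite sqr_sqrtr // !mulr_ge0 ?ln_nat_ge0 // ltW.
    exists C => //; exists 0%N => x xhat z omega q alg T T1 _.
    split=> [/andP[]|_|]; [lra| |lra].
    exact: HC _ _ _ _ _ alg T T1.
Qed.
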